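(* Let $\alpha=\beta>0$ (the critical case). For $\epsilon\in(0,1)$ let $\hat\tau(\epsilon n)$ be the first time the critical dynamic Erdős–Rényi graph on $n$ vertices, starting with no edges, has a (connected) component of size at least $\epsilon n$. Then for all $\hat\epsilon>\epsilon$ (with $\hat\epsilon<1$), $$\mathbb{E}[\hat\tau(\epsilon n)]=O(n^{-1/2})\,e^{n\left(\hat\epsilon^2/16+O_{\hat\epsilon}(\hat\epsilon^3)\right)}.$$ That is, there is a function $r:(0,1)\to\mathbb{R}$ with $r(x)=O(x^3)$ as $x\to0$ such that for all $0<\epsilon<\hat\epsilon<1$ there is a constant $M<\infty$ with $\mathbb{E}[\hat\tau(\epsilon n)]\le M n^{-1/2}e^{n(\hat\epsilon^2/16+r(\hat\epsilon))}$ for all sufficiently large $n$.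
   Context: Dynamic Erdős–Rényi graph: for $\alpha,\beta>0$ and an integer $n\ge2$, there are $n$ fixed vertices and, independently for each of the $\binom n2$ vertex pairs, if no edge is present an edge is added after an exponentially distributed time with rate $\frac{\beta}{n-1}$, and if an edge is present it is removed after an exponentially distributed time with rate $\alpha$. It is called critical when $\alpha=\beta$ (its stationary distribution is then the static Erdős–Rényi graph $G(n,1/n)$). The size of a component is its number of vertices. *)

(* Defs.v *)
From HB Require Export structures.
From mathcomp Require Export all_boot all_order all_algebra.
From mathcomp Require Export finmap.
From mathcomp Require Export all_classical all_reals all_analysis.
Export Order.TTheory GRing.Theory Num.Theory.
Export numFieldNormedType.Exports.

Set Implicit Arguments.
Unset Strict Implicit.
Unset Printing Implicit Defensive.

Local Open Scope ring_scope.

Definition vertex_pair (n : nat) := {e : {set 'I_n} | #|e| == 2%N}.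

(* A simple graph on the vertex set 'I_n is its set of edges. *)
Definition graph (n : nat) := {set vertex_pair n}.

Definition empty_graph (n : nat) : graph n := finset.set0.

Definition adjacent (n : nat) (G : graph n) : rel 'I_n :=
  fun u v => [exists e in G, val e == [set u; v]%SET].

Definition component (n : nat) (G : graph n) (v : 'I_n) : {set 'I_n} :=
  [set w | connect (adjacent G) v w]%SET.

Definition has_component_ge (R : realType) (n : nat) (x : R) (G : graph n) :=
  exists v : 'I_n, x <= #|component G v|%:R.

Section independence.
Context d (T : measurableType d) (R : realType) (P : probability T R).
Local Open Scope ereal_scope.

Definition mutually_independent (I : choiceType) (X : I -> {RV P >-> R}) :=
  forall (J : {fset I}) (A : I -> set R),
    (forall i, measurable (A i)) ->
    P (\bigcap_(i in [set` J]) (X i @^-1` A i))%classic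
      = \prod_(i <- J) P (X i @^-1` A i)%classic.

Definition has_exponential_law (X : {RV P >-> R}) (rate : R) :=
  forall A : set R, measurable A ->
    distribution P X A = exponential_prob rate A.

End independence.

Section dynamic_erdos_renyi.
Context d (T : measurableType d) (R : realType) (P : probability T R).
Variables (alpha beta : R) (n : nat) (G0 : graph n).

(* State (present or absent) of the pair [e] after its first [k] flips when
   the initial graph is [G0]. *)
Definition pair_state (e : vertex_pair n) (k : nat) : bool :=
  (e \in G0) (+) odd k.

(* [X (e, k)] is the time that the pair [e] spends in its state between its
   [k]-th and [k.+1]-th flips. *)
Definition dynamic_ER_clocks (X : vertex_pair n * nat -> {RV P >-> R}) :=
  mutually_independent X /\
  forall e k, has_exponential_law (X (e, k))
    (if pair_state e k then alpha else beta / (n%:R - 1)).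

Variable X : vertex_pair n * nat -> {RV P >-> R}.

Definition flip_time (e : vertex_pair n) (k : nat) (w : T) : R :=
  \sum_(i < k) X (e, nat_of_ord i) w.

(* The flip times of a pair almost surely increase to infinity; on the
   remaining null event the pair is absent at times lying in no interval
   between consecutive flips. *)
Definition dynamic_ER_graph (t : R) (w : T) : graph n :=
  [set e | `[< exists k, flip_time e k w <= t < flip_time e k.+1 w
                         /\ pair_state e k >]]%SET.

(* First time the graph has a component of at least [x] vertices (+oo if this
   never happens). *)
Definition tau_hat (x : R) (w : T) : \bar R :=
  ereal_inf [set t%:E | t in
    [set t : R | 0 <= t /\ has_component_ge x (dynamic_ER_graph t w)]]%classic.

End dynamic_erdos_renyi.

(* Main.v *)
Require Import Defs.
From mathcomp Require Import measurable_realfun zify ring lra.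

Set Implicit Arguments.
Unset Strict Implicit.
Unset Printing Implicit Defensive.

(** The bound comes from a restart argument.  At times [s_j = j * D] the state
of every vertex pair is given a fresh chance: whatever the history up to [s_j],
the pair is present a little later with conditional probability at least some
[p] close to [1 / n].  If the conditional probability were exactly [p], the
graphs seen at these later times would contain independent copies of the
Erdos-Renyi graph with edge probability [p], so the number of attempts until a
component of [k] vertices appears would be dominated by a geometric variable
with success probability [q], the probability that one such copy has a
component of size at least [k]; the hitting time would have mean at most
[D / q].

To make the probability exact without extra randomness, a pair is called
refreshed at time [s] when one particular event happens ([refreshed]).  If the
pair is present at [s], it must stay present for a further time [theta], where
[exp (- alpha * theta) = p].  If it is absent at [s], it must appear in one of
the [J] slots of length [h] that follow, and stay present for a prescribed time
that depends on the slot only.  By memorylessness both cases have conditional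
probability exactly [p] ([refreshed_after_prob]); both make the pair present at
time [s + J * h] ([refreshed_on]), and both are decided before [s + D]
([refreshed_past]).  Hence the refresh events of all pairs at all times [s_j]
are independent ([failures_prob]), which gives [hitting_time_bound].  The slots
form a Riemann sum for the true transition probability of the pair, so a small
[h] and a large [J] bring [p] as close to [1 / n] as desired
([refresh_prob_near]).

It remains to bound [q] from below ([big_component_prob_bound]).  A graph has at
most [n] components, so [n * q] is at least the expected number of components
that are trees with exactly [k] vertices.  By Cayley's formula this expectation
is about
[C(n, k) * k^(k-2) * p^(k-1) * (1-p)^(k * n - k * (k+1) / 2)], and for
[k = eps * n] and [p] between [(1 - eps) / n] and [1 / n] the terms of first and
second order in [eps] of the exponent cancel.  What is left is
[exp (- O(eps^3) * n)] up to powers of [n].  For [eps] away from [0] it suffices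
to take [k = n], since [eps^3] is then bounded below.

Altogether the mean hitting time is at most [K * n^3 * exp (24 * eps^3 * n)].
Passing from [eps] to a larger [epsh] gains an exponential factor that absorbs
the power of [n], so [r x = 24 * x^3] works. *)

(** * Counting rooted trees *)

Section Forests.
Local Open Scope nat_scope.
Variable V : finType.
Implicit Types (f : {ffun V -> V}) (S : {set V}).

(** Rooted forests on [S] are encoded by their parent functions: roots, and all
points outside [S], are fixed points, and acyclicity says that iterating the
function ends at fixed points. *)
Definition rooted_forest S f : bool :=
  [&& [forall u, (u \in S) || (f u == u)], [forall u in S, f u \in S] &
   `[< exists m, forall u, f (iter m f u) = iter m f u >] ].

Definition moved f : {set V} := [set u | f u != u]%SET.

Definition forests S i : {set {ffun V -> V}} :=
  [set f | rooted_forest S f && (#|moved f| == i)]%SET.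

(** The parent function of the forest in which the root [r] is grafted below [v]. *)
Definition redirect f (r v : V) : {ffun V -> V} :=
  [ffun u => if u == r then v else f u].

Lemma iter_fixed (T : Type) (g : T -> T) x m k :
  g (iter m g x) = iter m g x -> m <= k -> iter k g x = iter m g x.
Proof.
move=> gx; elim: k => [|k IH]; first by rewrite leqn0 => /eqP ->.
rewrite leq_eqVlt => /predU1P[->//|]; rewrite ltnS => /IH {}IH.
by rewrite iterS IH.
Qed.

(** Before its end, a path towards the roots only meets points that are not fixed,
so it cannot notice that the fixed point [r] has been redirected. *)
Lemma redirect_iter f r v m u : f r = r ->
  exists2 j, j <= m & iter j (redirect f r v) u = iter m f u \/
                      iter j (redirect f r v) u = r /\ iter m f u = r.
Proof.
move=> fr; elim: m u => [|m IH] u; first by exists 0 => //; left.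
have [->|ur] := eqVneq u r.
  exists 0 => //; right; split => //.
  by elim: m {IH} => //= m ->.
have [j jm H] := IH (f u); exists j.+1 => //.
have -> : iter j.+1 (redirect f r v) u = iter j (redirect f r v) (f u).
  by rewrite iterSr ffunE (negPf ur).
by rewrite iterSr.
Qed.

Lemma redirect_forest S f r v m : rooted_forest S f ->
  (forall u, f (iter m f u) = iter m f u) ->
  r \in S -> v \in S -> f r = r -> iter m f v != r ->
  rooted_forest S (redirect f r v).
Proof.
move=> /and3P[/forallP out /'forall_implyP ins _] fm rS vS fr rootv.
apply/and3P; split.
- apply/forallP => u; rewrite ffunE; case: (eqVneq u r) => [->|_]; first by rewrite rS.
  exact: out.
- apply/'forall_implyP => u uS; rewrite ffunE; case: (eqVneq u r) => // _.
  exact: ins.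
(* one path up to [r], the new edge, and one path up from [v] *)
- apply/asboolP; exists (m + m.+1) => u.
  set f' := redirect f r v.
  suff [j jm fj] : exists2 j, j <= m + m.+1 & f' (iter j f' u) = iter j f' u.
    by rewrite (iter_fixed fj).
  have key w : iter m f w != r -> exists2 j, j <= m & f' (iter j f' w) = iter j f' w.
    move=> wr; have [j jm [H|[_ H]]] := redirect_iter v m w fr; last first.
      by rewrite H eqxx in wr.
    by exists j => //; rewrite H /f' ffunE (negPf wr) fm.
  have [ur|ur] := eqVneq (iter m f u) r; last first.
    have [j jm H] := key _ ur; exists j => //.
    by rewrite (leq_trans jm)// leq_addr.
  have [j jm H] : exists2 j, j <= m & iter j f' u = r.
    by have [j jm [H|[H _]]] := redirect_iter v m u fr; exists j; rewrite // H.
  have [j' j'm H'] := key _ rootv.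
  have f'r : f' r = v by rewrite ffunE eqxx.
  exists (j' + j.+1); first by rewrite leq_add.
  by rewrite iterD iterS H f'r.
Qed.

Lemma moved_redirect f r v : f r = r -> v != r ->
  moved (redirect f r v) = (r |: moved f)%SET.
Proof.
move=> fr vr; apply/setP => u; rewrite !inE ffunE.
by case: (eqVneq u r) => [->|].
Qed.

Lemma moved_sub S f : rooted_forest S f -> moved f \subset S.
Proof.
case/and3P => /forallP out _ _; apply/fintype.subsetP => u; rewrite inE => fu.
by have := out u; rewrite (negPf fu) orbF.
Qed.

(** Double counting, after Pitman: a root [r] can be grafted below any vertex of
any of the other trees, which makes [#|S|] times (number of roots - 1) choices,
and the forest before the grafting is recovered from the result together with
[r], one of its [i.+1] vertices that are not roots. *)
Lemma forests_step S i :
  #|forests S i| * (#|S| * (#|S| - i.+1)) <= #|forests S i.+1| * i.+1.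
Proof.
pose rt f v := iter (xget 0 [set m | forall u, f (iter m f u) = iter m f u]%classic) f v.
have rtP f : f \in forests S i -> forall u, f (rt f u) = rt f u.
  rewrite inE => /andP[/and3P[_ _ /asboolP[m fm]] _] u; rewrite /rt.
  by case: xgetP => [m' _ /(_ u)//|/(_ m)].
pose A := [set x : {ffun V -> V} * (V * V) |
  [&& x.1 \in forests S i, x.2.1 \in S &
     x.2.2 \in ((S :\: moved x.1) :\ rt x.1 x.2.1)%SET ]]%SET.
pose B := [set x : {ffun V -> V} * V | (x.1 \in forests S i.+1) && (x.2 \in moved x.1)]%SET.
have cardA : #|A| = #|forests S i| * (#|S| * (#|S| - i.+1)).
  rewrite -sum1_card (eq_bigl (fun x => (x.1 \in forests S i) && ((x.2.1 \in S) &&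
     (x.2.2 \in ((S :\: moved x.1) :\ rt x.1 x.2.1)%SET)))); last by move=> x; rewrite inE.
  rewrite -(pair_big_dep (fun f => f \in forests S i) (fun f y => (y.1 \in S) &&
     (y.2 \in ((S :\: moved f) :\ rt f y.1)%SET)) (fun _ _ => 1)) /=.
  rewrite -[RHS]sum_nat_const; apply: eq_bigr => f fF.
  rewrite -(pair_big_dep (fun v => v \in S) (fun v r => r \in ((S :\: moved f) :\ rt f
    v)%SET) (fun _ _ => 1)) /=.
  rewrite -[RHS]sum_nat_const; apply: eq_bigr => v vS.
  rewrite sum1_card.
  have fF' := fF; rewrite inE in fF'; case/andP: fF' => fr /eqP mi.
  have rin : rt f v \in (S :\: moved f)%SET.
    rewrite !inE rtP// eqxx /=.
    case/and3P: fr => _ /'forall_implyP ins _.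
    by rewrite /rt; elim: (xget _ _) => //= k; exact: ins.
  have := cardsD1 (rt f v) (S :\: moved f)%SET; rewrite rin.
  rewrite cardsD (finset.setIidPr (moved_sub fr)) mi => E.
  by rewrite -addn1 subnDA E addKn.
have cardB : #|B| = #|forests S i.+1| * i.+1.
  rewrite -sum1_card (eq_bigl (fun x => (x.1 \in forests S i.+1) && (x.2 \in moved x.1)));
    last by move=> x; rewrite inE.
  rewrite -(pair_big_dep (fun f => f \in forests S i.+1) (fun f y => y \in moved f) (fun _ _
    => 1)) /=.
  rewrite -[RHS]sum_nat_const; apply: eq_bigr => f.
  by rewrite inE sum1_card => /andP[_ /eqP].
rewrite -cardA -cardB.
pose phi (x : {ffun V -> V} * (V * V)) := (redirect x.1 x.2.2 x.2.1, x.2.2).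
have phiinj : {in A &, injective phi}.
  move=> [f [v r]] [f' [v' r']]; rewrite !inE /= => /and3P[_ _ /and3P[_ fr _]].
  move=> /and3P[_ _ /and3P[_ fr' _]] [] E rr; subst r'.
  have -> : v' = v by have := congr1 (fun g : {ffun V -> V} => g r) E; rewrite !ffunE eqxx.
  congr (_, _); apply/ffunP => u.
  have := congr1 (fun g : {ffun V -> V} => g u) E; rewrite !ffunE.
  case: eqP => // -> _.
  by move: fr fr'; rewrite !negbK => /eqP -> /eqP ->.
rewrite -(card_in_imset phiinj); apply/subset_leq_card/fintype.subsetP => y /imsetP[[f [v r]]].
rewrite inE /= => /and3P[fF vS]; rewrite !inE negbK => /and3P[rr /eqP fr rS] -> /=.
have fF' := fF; rewrite inE in fF'; case/andP: fF' => fo /eqP mi.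
have rv : rt f v != r by rewrite eq_sym.
have vr : v != r.
  apply: contra_neq rv => ->; rewrite /rt; elim: (xget _ _) => //= k ->//.
rewrite ffunE eqxx vr andbT moved_redirect// cardsU1 mi inE fr eqxx /= add1n eqxx andbT.
by apply: redirect_forest fo _ rS vS fr rv; exact: rtP.
Qed.

Lemma card_forests S i : i < #|S| -> 'C(#|S|.-1, i) * #|S| ^ i <= #|forests S i|.
Proof.
elim: i => [|i IH] iS.
  rewrite bin0 expn0 muln1 card_gt0; apply/set0Pn; exists [ffun u => u].
  rewrite inE; apply/andP; split; last first.
    by rewrite cards_eq0; apply/eqP/setP => u; rewrite !inE ffunE eqxx.
  apply/and3P; split.
  - by apply/forallP => u; rewrite ffunE eqxx orbT.
  - by apply/'forall_implyP => u; rewrite ffunE.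
  - by apply/asboolP; exists 0 => u /=; rewrite ffunE.
rewrite -(leq_pmul2r (ltn0Sn i)); apply: leq_trans (forests_step S i).
have := IH (ltnW iS); rewrite -(leq_pmul2r (m := #|S| * (#|S| - i.+1))); last first.
  by rewrite muln_gt0 subn_gt0 iS (leq_ltn_trans _ iS).
apply: leq_trans; rewrite expnS mulnAC.
have -> : 'C(#|S|.-1, i.+1) * i.+1 = 'C(#|S|.-1, i) * (#|S| - i.+1).
  rewrite mulnC mul_bin_left mulnC; congr (_ * _).
  by case: #|S| iS => // k _; rewrite subSS.
by rewrite [_ * _ ^ i]mulnC mulnACA [_ * #|S|]mulnC.
Qed.

Definition trees S := forests S #|S|.-1.

(** Cayley's lower bound; the exponent is [#|S| - 1] instead of [#|S| - 2] because
the trees carry a root. *)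
Lemma card_trees S : S != finset.set0 -> #|S| ^ #|S|.-1 <= #|trees S|.
Proof.
rewrite -card_gt0 => S0; have := @card_forests S #|S|.-1.
by rewrite binn mul1n ltn_predL => /(_ S0).
Qed.

End Forests.

(** * Trees as isolated components of a graph *)

Section TreeRoots.
Local Open Scope nat_scope.
Variable V : finType.
Implicit Types (f : {ffun V -> V}) (S : {set V}).

(** Of the [#|S|] points of a tree all but one are moved, and the iterates of the
parent function stay in [S], so they all end at the remaining point. *)
Lemma tree_root S f : S != finset.set0 -> f \in trees S ->
  exists2 r, r \in S & f r = r /\
    exists m, forall u, u \in S -> iter m f u = r.
Proof.
move=> S0; rewrite inE => /andP[fS /eqP mf].
have : #|(S :\: moved f)%SET| == 1.
  rewrite cardsD (finset.setIidPr (moved_sub fS)) mf.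
  by move: S0; rewrite -card_gt0; case: #|S| => // k _; rewrite subSnn.
move=> /cards1P[r rE].
have : r \in (S :\: moved f)%SET by rewrite rE inE.
rewrite !inE negbK => /andP[/eqP fr rS]; exists r => //; split => //.
case/and3P: fS => _ /'forall_implyP ins /asboolP[m fm].
exists m => u uS; have : iter m f u \in (S :\: moved f)%SET.
  rewrite !inE fm eqxx /=.
  by elim: m {fm} => //= m; exact: ins.
by rewrite rE inE => /eqP.
Qed.

Lemma no_two_cycle f u m : f (iter m f u) = iter m f u -> f (f u) = u -> f u = u.
Proof.
move=> fm ffu.
have H k : iter k f u = u \/ iter k f u = f u.
  elim: k => [|k [IH|IH]] /=; [by left|right|left]; by rewrite IH.
by move: fm; have [->//|->] := H m; rewrite ffu => /esym.
Qed.

End TreeRoots.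

Section TreesInGraphs.
Local Open Scope nat_scope.
Variable n : nat.
Implicit Types (f : {ffun 'I_n -> 'I_n}) (S : {set 'I_n}) (g : graph n).

Definition tree_edges f : graph n :=
  [set e : vertex_pair n | [exists u, (f u != u) && (val e == [set u; f u])]]%SET.

Definition touching S : {set vertex_pair n} :=
  [set e : vertex_pair n | ~~ [disjoint val e & S]]%SET.

(** The subgraph of [g] on [S] is the tree [f], and [g] has no edge leaving [S]. *)
Definition isolated_tree g S f := (g :&: touching S == tree_edges f)%SET.

Definition pair_of (u v : 'I_n) (uv : u != v) : vertex_pair n :=
  Sub [set u; v]%SET (introT eqP (etrans (cards2 u v) (congr1 (fun b : bool => b.+1) uv))).

Lemma tree_edges_touching S f : rooted_forest S f -> tree_edges f \subset touching S.
Proof.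
move=> fS; apply/fintype.subsetP => e; rewrite !inE => /existsP[u /andP[fu /eqP ->]].
apply/pred0Pn; exists u; rewrite /= !inE eqxx /=.
by apply: (fintype.subsetP (moved_sub fS)); rewrite inE.
Qed.

Lemma card_tree_edges f : #|tree_edges f| <= #|moved f|.
Proof.
pose h u : option (vertex_pair n) := insub [set u; f u]%SET.
rewrite -(card_imset (tree_edges f) (@Some_inj _)).
apply: leq_trans (leq_imset_card h _); apply/subset_leq_card/fintype.subsetP => x.
case/imsetP => e; rewrite inE => /existsP[u /andP[fu /eqP eu]] ->.
apply/imsetP; exists u; first by rewrite inE.
by rewrite /h -eu valK.
Qed.

Lemma set2_inj (u v a b : 'I_n) : [set u; v]%SET = [set a; b]%SET ->
  (u = a /\ v = b) \/ (u = b /\ v = a).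
Proof.
move=> /setP H.
have Hu : u \in [set a; b]%SET by rewrite -H !inE eqxx.
have Hv : v \in [set a; b]%SET by rewrite -H !inE eqxx orbT.
have Ha : a \in [set u; v]%SET by rewrite H !inE eqxx.
have Hb : b \in [set u; v]%SET by rewrite H !inE eqxx orbT.
move: Hu Hv Ha Hb; rewrite !inE.
case/orP => /eqP ->; case/orP => /eqP ->; rewrite ?eqxx ?orbT ?orbb //=.
- by move=> _ /eqP ->; left.
- by left.
- by right.
- by move=> /eqP -> _; left.
Qed.

Lemma isolated_tree_adjacent g S f u : rooted_forest S f -> isolated_tree g S f ->
  f u != u -> adjacent g u (f u).
Proof.
move=> fS /eqP E fu; have uf : u != f u by rewrite eq_sym.
apply/existsP; exists (pair_of uf); apply/andP; split; last by [].
have : pair_of uf \in tree_edges f by rewrite inE; apply/existsP; exists u; rewrite fu /=.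
by rewrite -E inE => /andP[].
Qed.

Lemma isolated_tree_component g S f : S != finset.set0 -> f \in trees S ->
  isolated_tree g S f -> exists v, #|S| <= #|component g v|.
Proof.
move=> S0 fT E; have [r rS [fr [m mr]]] := tree_root S0 fT.
exists r; apply/subset_leq_card/fintype.subsetP => u uS; rewrite inE.
have fS : rooted_forest S f by move: fT; rewrite inE => /andP[].
have symg : symmetric (adjacent g).
  by move=> x y; rewrite /adjacent; apply: eq_existsb => e; rewrite finset.setUC.
rewrite (sym_connect_sym symg) -(mr u uS).
elim: m {mr uS} u => //= m IH u.
rewrite -iterS iterSr; apply: connect_trans (IH (f u)).
have [->//|fu] := eqVneq (f u) u.
exact/connect1/(isolated_tree_adjacent fS).
Qed.

(** Going up from the root [r] along the first tree, every edge of [g] met touches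
the second vertex set, hence belongs to the second tree as well; it is oriented
in the same way there, since otherwise the first parent function would have a
2-cycle. *)
Lemma isolated_tree_root_inj g S1 S2 f1 f2 r :
  f1 \in trees S1 -> f2 \in trees S2 -> isolated_tree g S1 f1 -> isolated_tree g S2 f2 ->
  S1 != finset.set0 -> r \in S1 -> r \in S2 -> f1 r = r -> f2 r = r ->
  forall u, u \in S1 -> u \in S2 /\ f2 u = f1 u.
Proof.
move=> f1T f2T E1 E2 S10 rS1 rS2 f1r f2r.
have [r' r'S [_ [m mr]]] := tree_root S10 f1T.
have {r' r'S}mr u : u \in S1 -> iter m f1 u = r.
  by move=> uS; rewrite mr// -(mr r)//; elim: m {mr} => //= m ->.
have fS1 : rooted_forest S1 f1 by move: f1T; rewrite inE => /andP[].
have fS2 : rooted_forest S2 f2 by move: f2T; rewrite inE => /andP[].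
suff H j u : u \in S1 -> iter j f1 u = r -> u \in S2 /\ f2 u = f1 u.
  by move=> u uS; apply: H uS (mr u uS).
elim: j u => [|j IH] u uS1; first by move=> /= ->; rewrite f1r f2r.
rewrite iterSr => iu.
have f1uS : f1 u \in S1 by case/and3P: fS1 => _ /'forall_implyP /(_ u uS1).
have [v2 f2v] := IH _ f1uS iu.
have [fu|fu] := eqVneq (f1 u) u; first by rewrite !fu in v2 f2v *.
have uf : u != f1 u by rewrite eq_sym.
have eg : pair_of uf \in g.
  have : pair_of uf \in tree_edges f1 by rewrite inE; apply/existsP; exists u; rewrite fu /=.
  by rewrite -(eqP E1) inE => /andP[].
have : pair_of uf \in tree_edges f2.
  rewrite -(eqP E2) !inE eg /=; apply/pred0Pn; exists (f1 u).
  by rewrite /= !inE eqxx orbT v2.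
rewrite inE => /existsP[a /andP[f2a /eqP /= /set2_inj[[ua va]|[ub vb]]]].
  rewrite -ua in va f2a; rewrite -va; split => //.
  by apply: (fintype.subsetP (moved_sub fS2)); rewrite inE.
have /no_two_cycle fuu : f1 (iter m f1 u) = iter m f1 u by rewrite mr.
by rewrite fuu ?eqxx // -f2v vb in fu.
Qed.

Definition root_set (x : {set 'I_n} * {ffun 'I_n -> 'I_n}) : {set 'I_n} :=
  [set u in x.1 | x.2 u == u]%SET.

(** An isolated tree is determined by its root, so there are at most [n] of them
for each graph.  This replaces counting the components, and it accounts at once
for the choice of the root in each of them. *)
Lemma isolated_tree_count g k : 0 < k ->
  #|[set x : {set 'I_n} * {ffun 'I_n -> 'I_n} |
     [&& #|x.1| == k, x.2 \in trees x.1 & isolated_tree g x.1 x.2]]%SET| <= n.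
Proof.
move=> k0; set A := [set x | _]%SET.
have AP x : x \in A -> exists r, root_set x = [set r]%SET /\ r \in x.1 /\ x.2 r = r.
  rewrite [x \in A]inE => /and3P[/eqP xk xT _].
  have x0 : x.1 != finset.set0 by rewrite -card_gt0 xk.
  have [r rS [fr [m mr]]] := tree_root x0 xT; exists r; split => //.
  apply/setP => u; rewrite !inE; apply/andP/eqP => [[uS /eqP fu]|->]; last by rewrite rS fr.
  by rewrite -(mr u uS); elim: m {mr} => //= m <-.
have inj : {in A &, injective root_set}.
  move=> x y xA yA E; have [r [xr [rx fx]]] := AP _ xA.
  have [r' [yr [ry fy]]] := AP _ yA; move: E; rewrite xr yr => /finset.set1_inj rr; subst r'.
  move: xA yA; rewrite [x \in A]inE [y \in A]inE => /and3P[/eqP xk xT xg] /and3P[/eqP yk yT yg].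
  have x0 : x.1 != finset.set0 by rewrite -card_gt0 xk.
  have y0 : y.1 != finset.set0 by rewrite -card_gt0 yk.
  have xy := isolated_tree_root_inj xT yT xg yg x0 rx ry fx fy.
  have yx := isolated_tree_root_inj yT xT yg xg y0 ry rx fy fx.
  have S12 : x.1 = y.1.
    by apply/setP => u; apply/idP/idP => [/xy[]|/yx[]].
  move: x y {xr yr rx ry fx fy xk yk AP x0 y0} xT yT {xg yg} xy yx S12.
  move=> [S f] [S' f'] /= fT f'T xy _ SS; subst S'; congr (_, _); apply/ffunP => u.
  have [uS|uS] := boolP (u \in S); first by have [] := xy _ uS.
  move: fT f'T; rewrite !inE => /andP[/and3P[/forallP/(_ u) H _ _] _].
  move=> /andP[/and3P[/forallP/(_ u) H' _ _] _].
  by move: H H'; rewrite (negPf uS) /= => /eqP -> /eqP ->.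
rewrite -(card_in_imset inj).
apply: (@leq_trans #|[set [set r]%SET | r : 'I_n]%SET|); last first.
  by apply: leq_trans (leq_imset_card _ _) _; rewrite card_ord.
apply/subset_leq_card/fintype.subsetP => _ /imsetP[x /AP[r [-> _]] ->].
exact: imset_f.
Qed.

(** The pairs that do not touch [S] are the pairs in the complement of [S]. *)
Lemma card_touching S : #|touching S| + 'C(n - #|S|, 2) = 'C(n, 2).
Proof.
have cardP (Q : {set {set 'I_n}}) : (forall e, e \in Q -> #|e| == 2) ->
    #|[set e : vertex_pair n | val e \in Q]%SET| = #|Q|.
  move=> Q2; rewrite -(card_imset _ val_inj); apply: eq_card => s.
  apply/imsetP/idP => [[e]|sQ]; first by rewrite inE => ? ->.
  by exists (Sub s (Q2 _ sQ)); rewrite ?inE /=.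
have -> : 'C(n, 2) = #|{: vertex_pair n}|.
  rewrite card_sig -{1}(card_ord n) -card_draws cardsE.
  by apply: eq_card => s; rewrite !inE.
rewrite -(cardsC (touching S)); congr (_ + _).
have -> : n - #|S| = #|~: S|%SET by rewrite -[X in X - _](card_ord n) -(cardsC S) addKn.
rewrite -cards_draws -cardP; last by move=> e; rewrite inE => /andP[].
apply: eq_card => e; rewrite !inE negbK (valP e) andbT.
by rewrite finset.disjoints_subset.
Qed.

End TreesInGraphs.

(** * The random graph with independent edges *)

Local Open Scope ring_scope.

Section RandomSubset.
Variables (R : realType) (E : finType) (p : R).

(** The law of a random subset that contains each point of [E] independently with
probability [p]. *)
Definition subset_prob (g : {set E}) : R :=
  \prod_e (if e \in g then p else 1 - p).

Lemma prodD_subsets (F G : E -> R) : \prod_e (F e + G e) =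
  \sum_(g : {set E}) \prod_e (if e \in g then F e else G e).
Proof. by rewrite bigA_distr. Qed.

Lemma sum_subset_prob : \sum_g subset_prob g = 1.
Proof.
rewrite /subset_prob -(prodD_subsets (fun=> p) (fun=> 1 - p)).
by rewrite big1// => e _; rewrite addrC subrK.
Qed.

(** Write the indicator of the event as a product over [E] and expand
[\prod_e (F e + G e)], where [F] and [G] are the weights of presence and absence. *)
Lemma subset_prob_trace (S t : {set E}) : t \subset S ->
  \sum_(g | (g :&: S)%SET == t) subset_prob g = p ^+ #|t| * (1 - p) ^+ #|(S :\: t)%SET|.
Proof.
move=> tS; pose F e := if (e \in S) ==> (e \in t) then p else 0.
pose G e := if (e \in S) ==> (e \notin t) then 1 - p else 0.
transitivity (\sum_(g : {set E}) \prod_e (if e \in g then F e else G e)).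
  rewrite big_mkcond; apply: eq_bigr => g _; case: ifPn => [/eqP gt|].
    apply: eq_bigr => e _; have := finset.in_setI e g S; rewrite gt /F /G.
    by case: (e \in g) (e \in S) (e \in t) => [] [] [].
  move=> gt; apply/esym/eqP/prodf_eq0.
  have [e] : exists e, (e \in (g :&: S)%SET) != (e \in t).
    apply/existsP; apply: contraR gt; rewrite negb_exists => /forallP H.
    by apply/eqP/setP => e; have := H e; rewrite negbK => /eqP.
  move=> et; exists e => //; move: et; rewrite /F /G inE.
  by case: (e \in g) (e \in S) (e \in t) (fintype.subsetP tS e) => [] [] [] //= /(_ isT).
rewrite -(prodD_subsets F G).
rewrite (bigID (fun e => e \in t)) /=.
rewrite (bigID (fun e => e \in (S :\: t)%SET) (fun e => e \notin t)) /=.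
rewrite [X in _ * (_ * X)]big1 ?mulr1; last first.
  move=> e; rewrite /F /G !inE; case: (e \in S) (e \in t) => [] [] //= _.
  by rewrite addrC subrK.
congr (_ * _).
  rewrite (eq_bigr (fun=> p)) ?prodr_const// => e et.
  by rewrite /F /G et (fintype.subsetP tS _ et) /= addr0.
rewrite (eq_bigl (fun e => e \in (S :\: t)%SET)); last first.
  by move=> e; rewrite !inE; case: (e \in t).
rewrite (eq_bigr (fun=> 1 - p)) ?prodr_const// => e.
by rewrite !inE /F /G => /andP[/negPf -> ->]; rewrite /= add0r.
Qed.

Lemma subset_prob_ge0 g : 0 <= p <= 1 -> 0 <= subset_prob g.
Proof.
by case/andP=> p0 p1; apply: prodr_ge0 => e _; case: ifP; rewrite ?subr_ge0.
Qed.

End RandomSubset.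

Section ComponentProb.
Variables (R : realType) (n : nat) (p : R).
Hypothesis p01 : 0 <= p <= 1.

Definition has_big_component k (g : graph n) := [exists v : 'I_n, k <= #|component g v|]%N.

Definition big_component_prob k : R := \sum_(g | has_big_component k g) subset_prob p g.

(** First moment: by [isolated_tree_count], [n] times the indicator of a component
of size at least [k] dominates the number of isolated trees with [k] vertices. *)
Lemma big_component_prob_ge_trees k : (0 < k <= n)%N ->
  'C(n, k)%:R * k%:R ^+ k.-1 * (p ^+ k.-1 * (1 - p) ^+ ('C(n, 2) - 'C(n - k, 2)))
    <= n%:R * big_component_prob k.
Proof.
case/andP=> k0 kn; have [p0 p1] := andP p01.
have q0 : 0 <= 1 - p by rewrite subr_ge0.
pose Q (g : graph n) (x : {set 'I_n} * {ffun 'I_n -> 'I_n}) :=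
  [&& #|x.1| == k, x.2 \in trees x.1 & isolated_tree g x.1 x.2].
apply: (@le_trans _ _ (\sum_g subset_prob p g * #|[set x | Q g x]%SET|%:R)); last first.
  rewrite /big_component_prob mulr_sumr [leRHS]big_mkcond; apply: ler_sum => g _.
  case: ifPn => [_|nb].
    by rewrite mulrC ler_wpM2r ?subset_prob_ge0// ler_nat isolated_tree_count.
  rewrite (_ : [set x | Q g x]%SET = finset.set0) ?cards0 ?mulr0//.
  apply/setP => -[S f]; rewrite !inE; apply/negP => /and3P[/eqP /= Sk fT gS].
  case/negP: nb; apply/existsP; rewrite -Sk; apply: isolated_tree_component gS => //.
  by rewrite -card_gt0 Sk.
under eq_bigr => g _.
  rewrite -sum1_card natr_sum mulr_sumr.
  rewrite (eq_bigl (Q g)); last by move=> x; rewrite inE.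
  under eq_bigr do rewrite mulr1.
  rewrite big_mkcond.
  over.
rewrite exchange_big /=.
rewrite -(pair_bigA _ (fun S f => \sum_g (if Q g (S, f) then subset_prob p g else 0))) /=.
have -> : 'C(n, k)%:R = \sum_(S : {set 'I_n} | #|S| == k) 1 :> R.
  rewrite sumr_const; congr (_ *+ _).
  by rewrite -{1}(card_ord n) -card_draws cardsE.
rewrite !mulr_suml [leLHS]big_mkcond; apply: ler_sum => S _.
case: ifPn => [/eqP Sk|_]; last first.
  by apply: sumr_ge0 => f _; apply: sumr_ge0 => g _; case: ifP => // _; exact: subset_prob_ge0.
rewrite mul1r.
apply: (@le_trans _ _ (\sum_(f in trees S) (p ^+ k.-1 * (1 - p) ^+ ('C(n, 2) - 'C(n - k, 2))))).
  rewrite sumr_const -[leRHS]mulr_natl ler_wpM2r ?mulr_ge0 ?exprn_ge0//.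
  by rewrite -natrX ler_nat -Sk card_trees// -card_gt0 Sk.
rewrite big_mkcond; apply: ler_sum => f _; case: ifPn => fT; last first.
  by apply: sumr_ge0 => g _; case: ifP => // _; exact: subset_prob_ge0.
rewrite -big_mkcond /Q /= Sk eqxx fT /=.
move: (fT); rewrite inE => /andP[fS /eqP mf].
rewrite (subset_prob_trace p (tree_edges_touching fS)).
have ek : (#|tree_edges f| <= k.-1)%N by rewrite -Sk -mf card_tree_edges.
apply: ler_pM; rewrite ?exprn_ge0//.
  exact: ler_wiXn2l.
apply: ler_wiXn2l => //; first by rewrite lerBlDr lerDl.
by rewrite -(card_touching S) Sk addnK subset_leq_card// finset.subsetDl.
Qed.

End ComponentProb.

(** * Lower bound on the probability of a large component *)

Section Estimates.
Variable R : realType.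
Implicit Types (x y p eps : R) (n k i : nat).

Lemma expRN_le_inv x : 0 <= x -> expR (- x) <= (1 + x)^-1.
Proof. by move=> x0; rewrite expRN lef_pV2 ?posrE ?expR_gt0 ?ltr_pwDl// expR_ge1Dx. Qed.

Lemma expRN_le1B x : 0 <= x -> x <= 1 / 2 -> expR (- (2 * x)) <= 1 - x.
Proof.
move=> x0 x1; apply: le_trans (expRN_le_inv _) _; first by rewrite mulr_ge0.
rewrite invf_ple ?posrE; [|nra|nra].
rewrite -[leLHS]mul1r ler_pdivrMr; nra.
Qed.

(** A sharper form of [expRN_le1B] for small [x]: it is used with [x = p] and
raised to the power [n], where only the error [n * p ^ 2] is affordable. *)
Lemma expRN_le1B2 x : 0 <= x -> x <= 1 / 2 -> expR (- (x + 2 * x ^+ 2)) <= 1 - x.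
Proof.
move=> x0 x1; apply: le_trans (expRN_le_inv _) _; first by nra.
rewrite invf_ple ?posrE; [|nra|nra].
rewrite -[leLHS]mul1r ler_pdivrMr; nra.
Qed.

(** The upper half of Stirling's formula, with a factor [k] instead of [sqrt k]. *)
Lemma fact_le_pow k : (0 < k)%N -> (k`!)%:R * expR 1 ^+ k <= expR 1 * k%:R * k%:R ^+ k :> R.
Proof.
case: k => // k _; elim: k => [|k IH]; first by rewrite (_ : 1`! = 1)%N ?expr1 ?mul1r ?mulr1.
rewrite factS natrM exprS mulrACA.
apply: (@le_trans _ _ (k.+2%:R * expR 1 * (expR 1 * k.+1%:R * k.+1%:R ^+ k.+1))).
  by rewrite ler_wpM2l ?mulr_ge0 ?expR_ge0.
have kk : 0 < k.+2%:R :> R by [].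
suff : expR 1 * k.+1%:R ^+ k.+2 <= k.+2%:R ^+ k.+2 :> R.
  move=> H; rewrite [leLHS](_ : _ = k.+2%:R * expR 1 * (expR 1 * k.+1%:R ^+ k.+2)); last first.
    by rewrite [k.+1%:R ^+ k.+2]exprS; ring.
  by rewrite [expR 1 * k.+2%:R]mulrC ler_wpM2l ?mulr_ge0 ?expR_ge0.
have -> : expR 1 = (expR (k.+2%:R^-1)) ^+ k.+2 :> R.
  by rewrite -expRM_natl mulfV.
rewrite -exprMn lerXn2r ?nnegrE ?mulr_ge0 ?expR_ge0//.
have := expR_ge1Dx (- k.+2%:R^-1 : R); rewrite expRN => H.
rewrite mulrC -ler_pdivlMr ?expR_gt0//.
apply: le_trans (ler_wpM2l (ltW kk) H).
by rewrite mulrDr mulr1 mulrN mulfV// -[k.+2%:R]natr1 addrK.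
Qed.

(** The exponent of [1 - p] in [big_component_prob_ge_trees] is [k * n] minus the sum
of [1, ..., k]; in this form it pairs up factor by factor with the falling
factorial in [C(n, k)]. *)
Lemma touching_count n k : (k <= n)%N ->
  ('C(n, 2) - 'C(n - k, 2) + \sum_(i < k) i.+1 = k * n)%N.
Proof.
move=> kn; elim: k kn => [|k IH] kn; first by rewrite subn0 subnn big_ord0.
rewrite big_ord_recr /= mulSn -(IH (ltnW kn)).
have E : ('C(n - k, 2) = 'C(n - k.+1, 2) + (n - k.+1))%N.
  by rewrite -[(n - k)%N](@prednK) ?subn_gt0// -subnS binS bin1.
have H1 : ('C(n - k, 2) <= 'C(n, 2))%N by apply: leq_bin2l; rewrite leq_subr.
have H2 : ('C(n - k.+1, 2) <= 'C(n, 2))%N by apply: leq_bin2l; rewrite leq_subr.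
move: E H1 H2 kn; move: (\sum_(i < k) _)%N ('C(n - k.+1, 2))%N ('C(n - k, 2))%N ('C(n, 2))%N.
move=> s a b c. lia.
Qed.

Lemma ffact_prod n k : (k <= n)%N -> (n ^_ k)%:R = \prod_(i < k) (n%:R - i%:R) :> R.
Proof.
elim: k => [|k IH] kn; first by rewrite big_ord0.
by rewrite ffactnSr natrM IH ?(ltnW kn)// big_ord_recr /= natrB// ltnW.
Qed.

(** Bernoulli's inequality bounds [1 + i * p] by [(1 + p) ^ i], and
[(1 - p) * (1 + p) <= 1]. *)
Lemma bernoulli_product_le1 p i : 0 <= p <= 1 -> (1 - p) ^+ i.+1 * (1 + i%:R * p) <= 1.
Proof.
case/andP=> p0 p1.
have q0 : 0 <= 1 - p by rewrite subr_ge0.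
have H : 1 + i%:R * p <= (1 + p) ^+ i.
  elim: i => [|i IH]; first by rewrite mul0r addr0.
  rewrite exprS; apply: le_trans (ler_wpM2l _ IH); last by lra.
  rewrite -[i.+1%:R]natr1; have : 0 <= i%:R :> R by []. nra.
apply: (@le_trans _ _ ((1 - p) ^+ i.+1 * (1 + p) ^+ i)).
  by rewrite ler_wpM2l ?exprn_ge0.
have s0 : 0 <= (1 - p) * (1 + p) by rewrite mulr_ge0// addr_ge0.
rewrite exprS -mulrA -exprMn; apply: mulr_ile1 => //; first exact: exprn_ge0.
  by lra.
by apply: exprn_ile1 => //; have := mulr_ge0 p0 p0; lra.
Qed.

(** The second order terms cancel: the loss [1 - i / n] of the falling factorial is
made up for by the factor [(1 - p) ^ - (i + 1)], up to [1 - 2 * eps ^ 2].  The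
first order terms cancel as well, because [x * exp (1 - x)] is stationary at
[x = n * p = 1].  Both errors are of order [eps ^ 2 * k], hence of order
[eps ^ 3 * n]. *)
Lemma big_component_prob_lower n k p eps : (0 < k <= n)%N -> (2 <= n)%N ->
  0 < eps -> eps <= 1 / 2 -> (forall i, (i < k)%N -> i%:R <= eps * n%:R) ->
  1 - eps <= n%:R * p -> n%:R * p <= 1 ->
  expR (- (6 * eps ^+ 2 * k%:R + 3)) <= n%:R ^+ 2 * big_component_prob n p k.
Proof.
move=> /[dup] /andP[k0 kn] kkn n2 e0 e2 ik p1 p2.
have n0 : 0 < n%:R :> R by rewrite ltr0n (leq_trans _ n2).
have n2R : 2 <= n%:R :> R by rewrite ler_nat.
have pp : 0 < p by nra.
have ph : p <= 1 / 2 by nra.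
have p01 : 0 <= p <= 1 by lra.
have q0 : 0 < 1 - p by lra.
have kR : 1 <= k%:R :> R by rewrite ler1n.
have knR : k%:R <= n%:R :> R by rewrite ler_nat.
have := big_component_prob_ge_trees p01 kkn; set M := ('C(n, 2) - _)%N; set L := (leLHS) => HL.
have H1 : n%:R ^+ k * (1 - 2 * eps ^+ 2) ^+ k * k%:R ^+ k.-1 * p ^+ k.-1 * (1 - p) ^+ (k * n)
    <= L * (k`!)%:R.
  rewrite -(touching_count kn) exprD /L.
  have -> : forall a b c d f : R, a * b * (c * d) * f = (f * a) * b * c * d by move=> *; ring.
  rewrite -natrM mulnC bin_ffact ffact_prod// mulrA mulrAC.
  have -> : forall a b c d f : R, a * b * c * d * f = (a * d) * b * c * f by move=> *; ring.
  rewrite !ler_wpM2r ?exprn_ge0 ?(ltW q0) ?(ltW pp)//.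
  rewrite -prodrXr -exprMn -[X in _ ^+ X](card_ord k) -prodr_const -big_split /=.
  apply: ler_prod => i _; apply/andP; split.
    by rewrite !mulr_ge0 ?exprn_ge0 ?(ltW q0)//; nra.
  have iE := ik i (ltn_ord i).
  have i0 : 0 <= i%:R :> R by [].
  have iB := bernoulli_product_le1 i p01.
  have ni : 0 <= n%:R - i%:R :> R by nra.
  have ip : 0 < 1 + i%:R * p by nra.
  apply: (@le_trans _ _ ((n%:R - i%:R) * ((1 - p) ^+ i.+1 * (1 + i%:R * p)))); last first.
    by rewrite ler_piMr.
  rewrite [leRHS](_ : _ = (n%:R - i%:R) * (1 + i%:R * p) * (1 - p) ^+ i.+1); last by ring.
  rewrite ler_wpM2r ?exprn_ge0 ?(ltW q0)//.
  have ip' : i%:R * (1 - eps) <= n%:R * (i%:R * p) by nra.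
  rewrite -(ler_pM2l n0).
  have ii : i%:R * i%:R <= eps ^+ 2 * n%:R ^+ 2 :> R by rewrite -exprMn expr2 ler_pM.
  nra.
have H2 : ((n%:R * p) * (1 - 2 * eps ^+ 2) * (1 - p) ^+ n * expR 1) ^+ k
   <= L * expR 1 * k%:R ^+ 2 * p.
  have kk0 : 0 < k%:R ^+ k :> R by rewrite exprn_gt0// ltr0n.
  have kE : forall z : R, z ^+ k = z ^+ k.-1 * z by move=> z; rewrite -exprSr prednK.
  have L0 : 0 <= L by rewrite /L !mulr_ge0 ?exprn_ge0 ?(ltW pp) ?(ltW q0).
  (* [H1] times [expR 1 ^+ k * (k * p)], with [k`!] bounded by [fact_le_pow] *)
  rewrite -(ler_pM2r kk0) !exprMn -exprM [(n * k)%N]mulnC.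
  have kp0 : 0 <= expR 1 ^+ k * (k%:R * p) by rewrite !mulr_ge0 ?exprn_ge0 ?expR_ge0 ?(ltW pp).
  have := ler_wpM2r kp0 H1.
  rewrite [leLHS](_ : _ = n%:R ^+ k * p ^+ k * (1 - 2 * eps ^+ 2) ^+ k *
    (1 - p) ^+ (k * n) * expR 1 ^+ k * k%:R ^+ k); last first.
    by rewrite [p ^+ k]kE [X in _ = _ * X]kE; ring.
  move=> /le_trans; apply.
  rewrite [leLHS](_ : _ = (k`!)%:R * expR 1 ^+ k * (L * k%:R * p)); last by ring.
  rewrite [leRHS](_ : _ = expR 1 * k%:R * k%:R ^+ k * (L * k%:R * p)); last by ring.
  rewrite ler_wpM2r ?fact_le_pow//; by rewrite mulr_ge0 ?(ltW pp)// mulr_ge0.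
(* the base of the power in [H2]; [x * expR (1 - x) >= 1 - (1 - x) ^+ 2] for [x = n * p] *)
have H3 : expR (- (6 * eps ^+ 2 + 2 / n%:R)) <=
    n%:R * p * (1 - 2 * eps ^+ 2) * (1 - p) ^+ n * expR 1.
  have ee : 0 <= 1 - 2 * eps ^+ 2 by nra.
  have a1 : expR (- (4 * eps ^+ 2)) <= 1 - 2 * eps ^+ 2.
    have := @expRN_le1B (2 * eps ^+ 2); rewrite mulrA -natrM; apply; nra.
  have a2 : expR (- (2 * eps ^+ 2)) <= n%:R * p * expR (1 - n%:R * p).
    apply: le_trans (expRN_le1B _ _) _; [nra|nra|].
    apply: (@le_trans _ _ (n%:R * p * (1 + (1 - n%:R * p)))); first by nra.
    by rewrite ler_wpM2l ?expR_ge1Dx// mulr_ge0// ltW.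
  have a3 : expR (- (n%:R * p)) * expR (- (2 / n%:R)) <= (1 - p) ^+ n.
    apply: (@le_trans _ _ (expR (- (p + 2 * p ^+ 2)) ^+ n)); last first.
      by rewrite lerXn2r ?nnegrE ?expR_ge0 ?(ltW q0)// expRN_le1B2// ltW.
    rewrite -expRM_natl -expRD ler_expR mulrN -opprD lerN2 mulrDr lerD2l.
    rewrite ler_pdivlMr//; nra.
  rewrite [leLHS](_ : _ = expR (- (2 * eps ^+ 2)) * expR (- (4 * eps ^+ 2)) *
    expR (- (2 / n%:R))); last first.
    by rewrite -!expRD; congr expR; ring.
  rewrite [leRHS](_ : _ = n%:R * p * expR (1 - n%:R * p) * (1 - 2 * eps ^+ 2) *
     (expR (n%:R * p) * (1 - p) ^+ n)); last first.
    by rewrite expRD expRN; field; rewrite gt_eqF ?expR_gt0.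
  apply: ler_pM; rewrite ?mulr_ge0 ?expR_ge0//.
    by apply: ler_pM; rewrite ?expR_ge0.
  by rewrite -ler_pdivrMl ?expR_gt0// -expRN.
have H4 : expR (- (6 * eps ^+ 2 * k%:R + 2)) <= L * expR 1 * k%:R ^+ 2 * p.
  apply: le_trans H2; apply: (@le_trans _ _ (expR (- (6 * eps ^+ 2 + 2 / n%:R)) ^+ k)).
    rewrite -expRM_natl ler_expR mulrN lerN2 mulrDr mulrC lerD2l mulrA.
    by rewrite ler_pdivrMr// mulrC ler_pM2l.
  by rewrite lerXn2r ?nnegrE ?expR_ge0// (le_trans _ H3)// expR_ge0.
have qq : 0 <= big_component_prob n p k by apply: sumr_ge0 => g _; exact: subset_prob_ge0.
rewrite (_ : - _ = - (6 * eps ^+ 2 * k%:R + 2) - 1); last by ring.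
rewrite expRD [expR (- 1)]expRN ler_pdivrMr ?expR_gt0//.
apply: le_trans H4 _.
rewrite mulrAC [leLHS](_ : _ = L * (k%:R ^+ 2 * p) * expR 1); last by ring.
rewrite ler_wpM2r ?expR_ge0//.
apply: (@le_trans _ _ (n%:R * big_component_prob n p k * (k%:R ^+ 2 * p))).
  by rewrite ler_wpM2r// mulr_ge0 ?exprn_ge0 ?(ltW pp).
rewrite [leLHS](_ : _ = (n%:R * p) * (k%:R ^+ 2 * big_component_prob n p k)); last by ring.
apply: (@le_trans _ _ (k%:R ^+ 2 * big_component_prob n p k)).
  by rewrite ler_piMl// mulr_ge0 ?exprn_ge0.
by rewrite ler_wpM2r// lerXn2r ?nnegrE.
Qed.

(** For [k = n] even crude estimates leave a bound exponential in [n], thanks to the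
number [n ^ (n - 1)] of rooted trees. *)
Lemma connected_prob_lower n p : (2 <= n)%N ->
  1 / 2 <= n%:R * p -> n%:R * p <= 1 ->
  expR (- (3 * n%:R)) <= n%:R ^+ 2 * big_component_prob n p n.
Proof.
move=> n2 p1 p2.
have n0 : 0 < n%:R :> R by rewrite ltr0n (leq_trans _ n2).
have n2R : 2 <= n%:R :> R by rewrite ler_nat.
have pp : 0 < p by nra.
have ph : p <= 1 / 2 by nra.
have p01 : 0 <= p <= 1 by lra.
have q0 : 0 < 1 - p by lra.
have nn : (0 < n <= n)%N by rewrite leqnn (leq_trans _ n2).
have qq : 0 <= big_component_prob n p n by apply: sumr_ge0 => g _; exact: subset_prob_ge0.
have := big_component_prob_ge_trees p01 nn; rewrite binn mul1r subnn subn0 => H.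
apply: (@le_trans _ _ (n%:R * big_component_prob n p n)); last first.
  by rewrite expr2 -mulrA ler_peMl ?mulr_ge0 ?(ltW n0)//; lra.
apply: le_trans H; rewrite mulrA -exprMn.
rewrite (_ : - _ = - n%:R + - (2 * n%:R)); last by ring.
rewrite expRD; apply: ler_pM; rewrite ?expR_ge0//.
  apply: (@le_trans _ _ ((1 / 2) ^+ n)).
    have e1 : expR (- 1) <= 1 / 2 :> R.
      have := @expRN_le1B (1 / 2); rewrite mulrA mulr1 divff// => H.
      by apply: le_trans (H _ _) _; lra.
    have e2 : 0 <= 1 / 2 :> R by lra.
    by rewrite -[n%:R]mulr1 -mulrN expRM_natl lerXn2r ?nnegrE ?expR_ge0.
  apply: (@le_trans _ _ ((1 / 2) ^+ n.-1)); last by rewrite lerXn2r ?nnegrE//; lra.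
  by apply: ler_wiXn2l; rewrite ?leq_pred//; lra.
apply: (@le_trans _ _ ((1 - p) ^+ (n * n))); last first.
  apply: ler_wiXn2l; rewrite ?(ltW q0)//; first by lra.
  by rewrite bin2 -divn2 (leq_trans (leq_div _ _))// leq_mul2l leq_pred orbT.
apply: (@le_trans _ _ (expR (- (2 * p)) ^+ (n * n))); last first.
  by rewrite lerXn2r ?nnegrE ?expR_ge0 ?(ltW q0)// expRN_le1B// ltW.
rewrite -expRM_natl ler_expR natrM mulrN lerN2; nra.
Qed.

(** Below [eps = 1 / 2] this is [big_component_prob_lower] with [k] just above
[eps * n]; above, [24 * eps ^ 3 >= 3] and [connected_prob_lower] is enough. *)
Lemma big_component_prob_bound n p eps : (2 <= n)%N -> 0 < eps < 1 ->
  1 - Num.min eps (1 / 2) <= n%:R * p -> n%:R * p <= 1 ->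
  exists k, eps * n%:R <= k%:R /\
    expR (- (24 * eps ^+ 3 * n%:R + 5)) <= n%:R ^+ 2 * big_component_prob n p k.
Proof.
move=> n2 /andP[e0 e1] p1 p2.
have n0 : 0 < n%:R :> R by rewrite ltr0n (leq_trans _ n2).
have en0 : 0 <= eps * n%:R by rewrite mulr_ge0 ?ltW.
case: (leP eps (1 / 2)) p1 => [e2 p1|e2 p1].
  have /andP[t1 t2] := truncn_itv en0; set t := Num.truncn _ in t1 t2.
  have tn : (t < n)%N.
    by rewrite -(ltr_nat R) (le_lt_trans t1)// -[ltRHS]mul1r ltr_pM2r.
  exists t.+1; split; first exact: ltW.
  apply: le_trans (big_component_prob_lower _ n2 e0 e2 _ p1 p2); rewrite ?tn//.
    rewrite ler_expR lerN2 -[t.+1%:R]natr1.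
    have : eps ^+ 2 * t%:R <= eps ^+ 3 * n%:R.
      by rewrite [eps ^+ 3]exprSr -mulrA ler_wpM2l ?exprn_ge0// ltW.
    have : eps ^+ 2 <= 1 / 4 by nra.
    have : 0 <= eps ^+ 3 * n%:R by rewrite mulr_ge0 ?exprn_ge0 ?ltW.
    lra.
  by move=> i; rewrite ltnS => it; apply: le_trans t1; rewrite ler_nat.
exists n; split; first by rewrite -[leRHS]mul1r ler_wpM2r ?ltW.
apply: le_trans (connected_prob_lower n2 _ p2); last by lra.
rewrite ler_expR lerN2.
have : 1 / 8 <= eps ^+ 3.
  by rewrite (_ : 1 / 8 = (1 / 2) ^+ 3); [rewrite lerXn2r ?nnegrE ?ltW//; lra|field].
nra.
Qed.

End Estimates.

(** * Independence of the past and memorylessness *)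

Local Open Scope classical_set_scope.
Local Open Scope ring_scope.

Section ExpTail.
Context d (T : measurableType d) (R : realType) (P : probability T R).

Lemma exponential_law_neg (Y : {RV P >-> R}) (rate : R) :
  has_exponential_law Y rate -> distribution P Y `]-oo, 0[%classic = 0%E.
Proof.
move=> ->//; apply: integral0_eq => x; rewrite /= in_itv /= => x0.
by rewrite lt0_exponential_pdf.
Qed.

Lemma exponential_law_le (Y : {RV P >-> R}) (rate a : R) : 0 < rate -> 0 <= a ->
  has_exponential_law Y rate ->
  distribution P Y `]-oo, a]%classic = (1 - (expR (- (rate * a)))%:E)%E.
Proof.
move=> r0 a0 Ye.
rewrite (_ : `]-oo, a]%classic = `]-oo, 0[%classic `|` `[0, a]%classic); last first.
  apply/seteqP; split => x /=; rewrite !in_itv /=.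
    by move=> xa; case: (ltP x 0) => x0; [left|right].
  by case=> [x0|/andP[]//]; apply: le_trans a0; exact: ltW.
rewrite measureU//; last first.
  by apply/seteqP; split => x //= []; rewrite !in_itv /= => x0 /andP[]; rewrite leNgt x0.
rewrite /= (exponential_law_neg Ye) add0e Ye// -mulNr.
move: a0; rewrite le_eqVlt => /predU1P[<-|a0]; last exact: exponential_prob_itv0c.
by rewrite set_itv1 mulr0 expR0 subee// /exponential_prob integral_set1.
Qed.

Lemma exponential_law_gt (Y : {RV P >-> R}) (rate a : R) : 0 < rate -> 0 <= a ->
  has_exponential_law Y rate ->
  distribution P Y `]a, +oo[%classic = (expR (- (rate * a)))%:E.
Proof.
move=> r0 a0 Ye.
rewrite (_ : `]a, +oo[%classic = ~` `]-oo, a]%classic); last by rewrite setCitvl.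
rewrite probability_setC//= (exponential_law_le r0 a0 Ye).
by rewrite oppeB// addeA subee// add0e.
Qed.
End ExpTail.

Section Past.
Context d (T : measurableType d) (R : realType) (P : probability T R).
Variables (I : choiceType) (X : I -> {RV P >-> R}).

(** Finite intersections of events about single clocks in [Q]; they form a pi-system. *)
Definition cylinders (Q : set I) : set (set T) :=
  [set A | exists (J : {fset I}) (B : I -> set R),
     [/\ forall i, measurable (B i), forall i, i \in J -> Q i &
         A = \bigcap_(i in [set` J]) X i @^-1` B i]].

(** The probability space with the sigma-algebra generated by the clocks in [Q].
It is a type, so that the measurability lemmas for functions apply to it. *)
Definition past (Q : set I) := g_sigma_algebraType (cylinders Q).

Lemma setI_closed_cylinders Q : setI_closed (cylinders Q).
Proof.
move=> _ _ [J [B [mB JQ ->]]] [J' [B' [mB' JQ' ->]]].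
exists (J `|` J')%fset, (fun i => (if i \in J then B i else setT) `&`
                                  (if i \in J' then B' i else setT)).
split.
- by move=> i; apply: measurableI; case: ifP.
- by move=> i; rewrite in_fsetU => /orP[/JQ|/JQ'].
apply/seteqP; split => w /=.
  move=> [H H'] i /= _; split; case: ifPn => // iJ; [exact: H|exact: H'].
move=> H; split => i /= iJ; have /= := H i; rewrite in_fsetU iJ ?orbT => /(_ isT) [] //.
Qed.

Lemma past_measurable Q (A : set T) :
  measurable (A : set (past Q)) -> measurable A.
Proof.
apply: smallest_sub; first exact: sigma_algebra_measurable.
move=> _ [J [B [mB _ ->]]]; rewrite bigcap_fset.
apply: (big_ind measurable) => // [|i _]; first exact: measurableI.
by rewrite -[X in measurable X]setTI; apply: measurable_funPT.
Qed.

Lemma measurable_past (Q : set I) i : Q i ->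
  measurable_fun setT (X i : past Q -> R).
Proof.
move=> Qi _ B mB; rewrite setTI; apply: sub_sigma_algebra.
exists [fset i]%fset, (fun=> B); split => //.
  by move=> j; rewrite inE => /eqP ->.
apply/seteqP; split => w /=; first by move=> Bw j /=; rewrite inE => /eqP ->.
by move=> /(_ i); rewrite /= inE eqxx; apply.
Qed.

Hypothesis indep : mutually_independent X.

(** Dynkin's theorem extends the independence from cylinders to the sigma-algebra
that they generate. *)
Lemma past_independent (Q : set I) i (A : set T) (B : set R) : ~ Q i ->
  measurable (A : set (past Q)) -> measurable B ->
  P (A `&` X i @^-1` B) = (P A * P (X i @^-1` B))%E.
Proof.
move=> nQi mA mB.
have mXB : measurable (X i @^-1` B).
  by rewrite -[X in measurable X]setTI; apply: measurable_funPT.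
have PXf : P (X i @^-1` B) \is a fin_num by rewrite fin_num_measure.
apply: (@dynkin_induction _ (past Q) (cylinders Q)
  [set A | P (A `&` X i @^-1` B) = (P A * P (X i @^-1` B))%E]) => //=.
- exact: setI_closed_cylinders.
- by rewrite setTI probability_setT mul1e.
- move=> _ /= [J [C [mC JQ ->]]].
  have iJ : i \notin J by apply/negP => /JQ.
  pose C' j := if j == i then B else C j.
  have mC' j : measurable (C' j) by rewrite /C'; case: ifP.
  have := indep (i |` J)%fset mC'; have := indep J mC.
  rewrite big_fsetU1//= => ->.
  have -> : \bigcap_(j in [set` (i |` J)%fset]) X j @^-1` C' j =
    \bigcap_(j in [set` J]) X j @^-1` C j `&` X i @^-1` B.
    apply/seteqP; split => w /=.
      move=> H; split; last by have /= := H i; rewrite /C' !inE eqxx; apply.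
      move=> j /= jJ; have /= := H j; rewrite !inE jJ orbT /C' => /(_ isT).
      by case: eqP jJ => // ->; rewrite (negPf iJ).
    move=> [H1 H2] j /=; rewrite !inE /C' => /orP[/eqP ->|jJ]; first by rewrite eqxx.
    by case: eqP jJ => [->|_ jJ]; [rewrite (negPf iJ)|exact: H1].
  move=> ->; rewrite muleC; congr (_ * _)%E; last by rewrite /C' eqxx.
  by apply: eq_big_seq => j jJ; rewrite /C'; case: eqP jJ => // ->; rewrite (negPf iJ).
- move=> S /past_measurable mS; rewrite /= => IH.
  rewrite setIC -setDE measureD//; last by rewrite -ge0_fin_numE// fin_num_measure.
  by rewrite /= setIC IH probability_setC// muleBl// ?mul1e// ?fin_num_measure.
- move=> F mF tF IH /=.
  have mF' n : d.-measurable (F n : set T) := past_measurable (mF n).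
  rewrite setI_bigcupl measure_semi_bigcup//; last 3 first.
  + by move=> n; exact: measurableI.
  + exact: trivIset_setIr.
  + by apply: bigcup_measurable => n _; exact: measurableI.
  rewrite (eq_eseriesr (g := fun n => ((fine (P (X i @^-1` B)))%:E * P (F n))%E)); last first.
    by move=> n _; rewrite fineK// muleC; exact: IH.
  rewrite nneseriesZl ?fineK// muleC; congr (_ * _)%E.
  by rewrite measure_semi_bigcup//; exact: bigcup_measurable.
Qed.

(** The joint law of [(U, Y)] is a product measure, so the event is the integral
over [u <= s] of the exponential tail at [s + x - u], and [exp (- rate * x)]
factors out. *)
Lemma memoryless (U Y : {RV P >-> R}) (rate s x : R) : 0 < rate -> 0 <= x ->
  (forall A B, measurable A -> measurable B ->
     P (U @^-1` A `&` Y @^-1` B) = (P (U @^-1` A) * P (Y @^-1` B))%E) ->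
  has_exponential_law Y rate ->
  P [set w | U w <= s /\ s + x < U w + Y w] =
    ((expR (- (rate * x)))%:E * P [set w | (U w <= s /\ s < U w + Y w)%R])%E.
Proof.
move=> r0 x0 UY Yexp.
have mUY : measurable_fun setT (fun w => (U w, Y w)).
  by apply: measurable_fun_pair.
pose UYf : {mfun T >-> (R * R)%type} := mfun_Sub (mem_set mUY).
have prodE (A : set (R * R)) : measurable A ->
    (distribution P U \x distribution P Y)%E A = distribution P UYf A.
  apply: product_measure_unique => B C mB mC.
  exact: UY.
pose A x := [set uv : R * R | (uv.1 <= s) && (s + x < uv.1 + uv.2)].
have mA z : measurable (A z).
  rewrite -[X in measurable X]setTI.
  have : measurable_fun setT (fun uv : R * R =>
     (uv.1 <= s) && (s + z < uv.1 + uv.2)).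
    apply: measurable_and.
      by apply: measurable_fun_ler => //.
    by apply: measurable_fun_ltr => //; apply: measurable_funD.
  by move=> /(_ measurableT [set true]); apply.
have AE z : 0 <= z -> P [set w | U w <= s /\ s + z < U w + Y w] =
    (\int[distribution P U]_u ((expR (- (rate * z)))%:E * (if (u <=
      s)%R then (expR (- (rate * (s - u))))%:E else 0)))%E.
  move=> z0; transitivity (distribution P UYf (A z)).
    by congr (P _); apply/seteqP; split => w /= ; [case=> ? ?; apply/andP|move/andP].
  rewrite -prodE// /product_measure1; apply: eq_integral => u _ /=.
  rewrite (_ : xsection (A z) u = if u <= s then `]s + z - u, +oo[%classic else set0); last first.
    apply/seteqP; split => v; rewrite /xsection /A /= !inE /=.
      by move=> /andP[-> ?]; rewrite /= in_itv /= andbT ltrBlDl.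
    by case: ifP => //= _; rewrite in_itv /= andbT ltrBlDl.
  case: ifPn => us; last by rewrite mule0 measure0.
  rewrite (exponential_law_gt r0 _ Yexp); last by lra.
  by rewrite -EFinM -expRD; congr (expR _)%:E; ring.
rewrite AE//.
have -> : [set w | U w <= s /\ s < U w + Y w] = [set w | U w <= s /\ s + 0 < U w + Y w].
  by rewrite addr0.
rewrite AE// mulr0 oppr0 expR0.
have mf : measurable_fun [set: R] (fun u : R => if u <= s then (expR (- (rate *
  (s - u))))%:E else 0%E).
  apply: measurable_fun_ifT => //; first exact: measurable_fun_ler.
  apply/measurable_EFinP; apply: measurableT_comp => //.
  apply: measurable_funN; apply: measurable_funM => //.
  exact: measurable_funB.
rewrite ge0_integralZl_EFin ?expR_ge0//; last first.
  by move=> u _; case: ifP => // _; rewrite lee_fin expR_ge0.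
by under [in RHS]eq_integral do rewrite mul1e.
Qed.

End Past.

(** * Jump times and refreshed pairs along a path of waiting times *)

Section Paths.
Variables (R : realType) (J : nat) (h theta : R).
Implicit Types (x : nat -> R) (s : R).

Definition jump_time x k : R := \sum_(i < k) x i.

(** At time [s] exactly [k] jumps have occurred, in the sense that [k.+1] is the
first index whose jump time exceeds [s].  Stated through the first passage, it
is unambiguous even when some waiting times are negative. *)
Definition jump_count x s k := (forall i, (i <= k)%N ->
  jump_time x i <= s) /\ s < jump_time x k.+1.

(** The [k.+1]-st jump falls in the [i]-th slot of length [h] after [s], and the next
waiting time is so long that it reaches past [s + J * h] wherever in the slot
the jump falls. *)
Definition lands x s k i :=
  s + i%:R * h < jump_time x k.+1 <= s + i.+1%:R * h /\ (J - i)%:R * h < x k.+1.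

(** The two ways of being refreshed, according to the state after [k] jumps, which
is present when [k] is odd. *)
Definition refreshed_after x s k : Prop :=
  if odd k then is_true (s + theta < jump_time x k.+1) else exists2 i, (i < J)%N & lands x s k i.

Definition refreshed x s := exists k, jump_count x s k /\ refreshed_after x s k.

Lemma jump_timeS x k : jump_time x k.+1 = jump_time x k + x k.
Proof. exact: big_ord_recr. Qed.

Lemma eq_jump_time x x' k j : (forall i, (i < k)%N -> x i = x' i) -> (j <= k)%N ->
  jump_time x j = jump_time x' j.
Proof. by move=> xx jk; apply: eq_bigr => i _; rewrite xx// (leq_trans _ jk). Qed.

Lemma jump_count_inj x s k k' : jump_count x s k -> jump_count x s k' -> k = k'.
Proof.
wlog kk : k k' / (k <= k')%N.
  by move=> H c c'; case/orP: (leq_total k k') => kk; [|apply/esym]; apply: H.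
move=> [_ c] [c' _]; apply/eqP; rewrite eqn_leq kk leqNgt /=.
by apply/negP => /c'; rewrite leNgt c.
Qed.

Hypothesis h0 : 0 <= h.

Lemma refreshed_on x s : 0 <= theta -> J%:R * h <= theta -> refreshed x s ->
  exists2 k, odd k & jump_time x k <= s + J%:R * h < jump_time x k.+1.
Proof.
move=> th0 Jth [k [[c1 c2]]]; rewrite /refreshed_after; case: ifPn => ok.
  move=> st; exists k => //; apply/andP; split.
    by apply: le_trans (c1 k (leqnn _)) _; rewrite lerDl mulr_ge0.
  by apply: le_lt_trans st; rewrite lerD2l.
case=> i iJ [/andP[l1 l2] l3]; exists k.+1 => //; apply/andP; split.
  by apply: le_trans l2 _; rewrite lerD2l ler_wpM2r// ler_nat.
by rewrite jump_timeS; move: l3; rewrite natrB 1?ltnW// mulrBl; lra.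
Qed.

(** Being refreshed at time [s] is decided before time [s + D].  If the next jump
[k.+1] comes after [s + D] in both sequences, the waiting times from [k] on are
irrelevant: the only condition on them that could matter, the length of the
waiting time [k] after a jump [k] that lands in a slot, holds automatically. *)
Lemma refreshed_past x x' s k D : theta <= D -> J.+1%:R * h <= D ->
  (forall i, (i < k)%N -> x i = x' i) ->
  s + D < jump_time x k.+1 -> s + D < jump_time x' k.+1 -> refreshed x s -> refreshed x' s.
Proof.
move=> thD JD xx sx sx' [k' [[c1 c2] g]].
have D0 : 0 <= D by apply: le_trans JD; rewrite mulr_ge0.
have k'k : (k' <= k)%N.
  rewrite leqNgt; apply/negP => /c1; rewrite leNgt; apply/negP.
  by rewrite negbK; apply: le_lt_trans sx; rewrite lerDl.
exists k'; split.
  split; first by move=> i ik; rewrite -(eq_jump_time xx) ?c1// (leq_trans ik).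
  move: k'k; rewrite leq_eqVlt => /predU1P[->|k'k]; last by rewrite -(eq_jump_time xx).
  by apply: le_lt_trans sx'; rewrite lerDl.
move: g; rewrite /refreshed_after; case: ifPn => ok.
  move: k'k; rewrite leq_eqVlt => /predU1P[-> _|k'k]; last by rewrite (eq_jump_time xx).
  by apply: le_lt_trans sx'; rewrite lerD2l.
case=> i iJ [/andP[l1 l2] l3]; exists i => //.
have iD : i.+1%:R * h <= D.
  by apply: le_trans JD; rewrite ler_wpM2r// ler_nat ltnS ltnW.
move: k'k; rewrite leq_eqVlt => /predU1P[kk|k'k].
  by move: sx; rewrite -kk ltNge => /negP; case; apply: le_trans l2 _; rewrite lerD2l.
rewrite /lands -(eq_jump_time xx k'k) l1 l2; split => //.
move: k'k; rewrite leq_eqVlt => /predU1P[kk|k'k]; last by rewrite -xx.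
move: sx'; rewrite -kk jump_timeS -(eq_jump_time (k := k'.+1) (x := x)) => [H|j jk|//];
  last first.
  by apply: xx; rewrite -kk.
rewrite natrB 1?ltnW// mulrBl.
have : J.+1%:R * h = J%:R * h + h by rewrite -natr1 mulrDl mul1r.
have : i.+1%:R * h = i%:R * h + h by rewrite -natr1 mulrDl mul1r.
by move: JD l2 H; lra.
Qed.

End Paths.

Section PathsMeasurable.
Context d (T : measurableType d) (R : realType).
Variables (Y : nat -> T -> R).

Lemma measurable_jump_time K k : (forall i, (i < K)%N -> measurable_fun setT (Y i)) ->
  (k <= K)%N ->
  measurable_fun setT (fun w => jump_time (Y^~ w) k).
Proof.
move=> mY kK.
rewrite (_ : (fun w => _) = (fun w => \sum_(i <- index_enum 'I_k) Y i w)); last by [].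
apply: measurable_sum => i; apply: mY; exact: leq_trans (ltn_ord i) kK.
Qed.

Lemma measurable_ltset (f g : T -> R) : measurable_fun setT f -> measurable_fun setT g ->
  measurable [set w | f w < g w].
Proof.
move=> mf mg; rewrite -[X in measurable X]setTI.
by have /(_ measurableT [set true]) := measurable_fun_ltr mf mg; apply.
Qed.

Lemma measurable_leset (f g : T -> R) : measurable_fun setT f -> measurable_fun setT g ->
  measurable [set w | f w <= g w].
Proof.
move=> mf mg; rewrite -[X in measurable X]setTI.
by have /(_ measurableT [set true]) := measurable_fun_ler mf mg; apply.
Qed.

(** The bound [K] matters: with the sigma-algebra of the past only the first [K]
waiting times are measurable. *)
Lemma measurable_jump_times_le K s k : (forall i, (i < K)%N -> measurable_fun setT (Y i)) ->
  (k <= K)%N ->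
  measurable [set w | forall i, (i <= k)%N -> jump_time (Y^~ w) i <= s].
Proof.
move=> mY kK.
rewrite (_ : mkset _ = \bigcap_(i in `I_k.+1) [set w | jump_time (Y^~ w) i <= s]); last first.
  by apply/seteqP; split => w /= H i ?; exact: H.
apply: bigcap_measurable; first by exists 0%N.
move=> i /= ik; apply: measurable_leset => //; apply: measurable_jump_time mY _.
exact: leq_trans kK.
Qed.

Lemma measurable_jump_count s k : (forall i, measurable_fun setT (Y i)) ->
  measurable [set w | jump_count (Y^~ w) s k].
Proof.
move=> mY; apply: measurableI.
  by apply: (@measurable_jump_times_le k.+1) => // i _; exact: mY.
apply: measurable_ltset => //; apply: (@measurable_jump_time k.+1) => // i _; exact: mY.
Qed.

Lemma measurable_lands J h s k i : (forall i, measurable_fun setT (Y i)) ->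
  measurable [set w | lands J h (Y^~ w) s k i].
Proof.
move=> mY; have mj : measurable_fun setT (fun w => jump_time (Y^~ w) k.+1).
  by apply: (@measurable_jump_time k.+1) => // j _; exact: mY.
apply: measurableI; last exact: measurable_ltset.
rewrite (_ : (fun w => _) = [set w | s + i%:R * h < jump_time (Y^~ w) k.+1] `&`
   [set w | jump_time (Y^~ w) k.+1 <= s + i.+1%:R * h]); last first.
  by apply/seteqP; split => w /= => [/andP//|[? ?]]; apply/andP.
by apply: measurableI; [exact: measurable_ltset|exact: measurable_leset].
Qed.

Lemma measurable_refreshed J h theta s : (forall i, measurable_fun setT (Y i)) ->
  measurable [set w | refreshed J h theta (Y^~ w) s].
Proof.
move=> mY.
rewrite (_ : mkset _ = \bigcup_k ([set w | jump_count (Y^~ w) s k] `&`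
     [set w | refreshed_after J h theta (Y^~ w) s k])); last first.
  by apply/seteqP; split => w /= [k]; exists k.
apply: bigcup_measurable => k _; apply: measurableI; first exact: measurable_jump_count.
rewrite /refreshed_after; case: (odd k).
  apply: measurable_ltset => //; apply: (@measurable_jump_time k.+1) => // i _; exact: mY.
rewrite (_ : mkset _ = \bigcup_(i in `I_J) [set w | lands J h (Y^~ w) s k i]); last first.
  by apply/seteqP; split => w /= [i]; exists i.
by apply: bigcup_measurable => i _; exact: measurable_lands.
Qed.

End PathsMeasurable.

(** * Conditional probability of being refreshed *)

Section Refresh.
Context d (T : measurableType d) (R : realType) (P : probability T R).
Variables (E : finType) (X : E * nat -> {RV P >-> R}) (a b : R).
Hypotheses (a0 : 0 < a) (b0 : 0 < b).
Hypothesis indep : mutually_independent X.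
Hypothesis law : forall e k, has_exponential_law (X (e, k)) (if odd k then a else b).

Definition clock_path e w : nat -> R := fun k => X (e, k) w.

Definition clocks_before (e : E) (k : nat) : set (E * nat) :=
  [set i | i.1 <> e \/ (i.2 < k)%N].

Lemma clock_past e k i : (i < k)%N ->
  measurable_fun setT (fun w : past X (clocks_before e k) => clock_path e w i).
Proof. by move=> ik; apply: measurable_past; right. Qed.

Lemma clock_measurable e i : measurable_fun setT (fun w => clock_path e w i).
Proof. exact: measurable_funPT. Qed.

Lemma jump_time_past e k j : (j <= k)%N ->
  measurable_fun setT (fun w : past X (clocks_before e k) => jump_time (clock_path e w) j).
Proof.
exact: (measurable_jump_time (Y :=
  fun i (w : past X (clocks_before e k)) => clock_path e w i) (@clock_past e k)).
Qed.

Lemma measurable_clock_jump_time e j : measurable_fun setT (fun w => jump_time (clock_path e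
  w) j).
Proof.
by apply: (measurable_jump_time (Y := fun i w => clock_path e w i) (K := j)) => // i _;
  exact: clock_measurable.
Qed.

Definition rate k : R := if odd k then a else b.

Lemma rate_gt0 k : 0 < rate k. Proof. by rewrite /rate; case: ifP. Qed.

(** Memorylessness given an event [D] of the past.  To reduce it to [memoryless],
the jump time is replaced off [D] by [s + 1], which the condition [U w <= s]
then excludes. *)
Lemma residual_memoryless e k s x (D : set T) : 0 <= x ->
  measurable (D : set (past X (clocks_before e k))) ->
  D `<=` [set w | jump_time (clock_path e w) k <= s] ->
  P (D `&` [set w | s + x < jump_time (clock_path e w) k.+1]) =
    ((expR (- (rate k * x)))%:E * P (D `&` [set w | (s < jump_time (clock_path e w) k.+1)%R]))%E.
Proof.
move=> x0 mD Ds.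
(* [U] is the jump time on [D] and [s + 1] elsewhere *)
pose U w := s + 1 + \1_D w * (jump_time (clock_path e w) k - s - 1).
have mUp : measurable_fun setT (U : past X (clocks_before e k) -> R).
  apply: measurable_funD => //; apply: measurable_funM.
    exact: measurable_indic.
  by apply: measurable_funB => //; apply: measurable_funB => //; exact: jump_time_past.
have mU : measurable_fun setT U.
  move=> _ B mB; rewrite setTI; apply: (@past_measurable _ _ _ _ _ X (clocks_before e k)).
  by rewrite -[X in measurable X]setTI; exact: mUp.
pose Uf : {RV P >-> R} := mfun_Sub (mem_set mU).
have UD w : U w <= s <-> D w.
  rewrite /U indicE; split=> [|Dw].
    by apply: contraPP => nD; rewrite memNset// mul0r addr0; apply/negP; rewrite -ltNge ltrDl.
  by rewrite mem_set// mul1r; have := Ds _ Dw; rewrite /=; lra.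
have eqU y : D `&` [set w | s + y < jump_time (clock_path e w) k.+1] =
    [set w | Uf w <= s /\ s + y < Uf w + X (e, k) w].
  apply/seteqP; split => w /=.
    move=> [Dw]; rewrite jump_timeS => ltw; split; first exact/UD.
    by move: ltw; rewrite /= /U indicE mem_set// mul1r /clock_path; lra.
  move=> [/UD Dw]; rewrite /= /U indicE mem_set// mul1r => ltw; split => //.
  by rewrite jump_timeS; move: ltw; rewrite /clock_path; lra.
have := @memoryless _ _ _ P Uf (X (e, k)) (rate k) s x (rate_gt0 k) x0.
rewrite eqU (_ : [set w | s < _] = [set w | s + 0 < jump_time (clock_path e w) k.+1]);
  last by rewrite addr0.
rewrite eqU addr0; apply; last exact: law.
move=> A B mA mB; apply: (past_independent indep (Q := clocks_before e k)) => //.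
  by case=> //=; rewrite ltnn.
by rewrite -[X in measurable X]setTI; exact: mUp.
Qed.

Variables (J : nat) (h theta : R).
Hypothesis h0 : 0 <= h.
Hypothesis th0 : 0 <= theta.

(** [b] is the rate of appearance and [a] the rate of removal.  The [i]-th term is
the probability to appear in the [i]-th slot and then to stay present for the
time [(J - i) * h]. *)
Definition refresh_prob : R :=
  (1 - expR (- (b * h))) *
  \sum_(i < J) (expR (- (b * (i%:R * h))) * expR (- (a * ((J - i)%:R * h)))).

Hypothesis theta_prob : expR (- (a * theta)) = refresh_prob.

Definition count_event e s k := [set w | jump_count (clock_path e w) s k].
Definition refreshed_after_event e s k :=
  [set w | refreshed_after J h theta (clock_path e w) s k].
Definition refresh_event e s := [set w | refreshed J h theta (clock_path e w) s].

Lemma measurable_count_event e s k : measurable (count_event e s k).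
Proof. exact: (measurable_jump_count _ _ (clock_measurable e)). Qed.

Lemma measurable_refresh_event e s : measurable (refresh_event e s).
Proof. exact: (measurable_refreshed _ _ _ _ (clock_measurable e)). Qed.

Lemma measurable_jump_time_gt e k x : measurable [set w | x < jump_time (clock_path e w) k].
Proof. by apply: measurable_ltset => //; exact: measurable_clock_jump_time. Qed.

(** The key computation.  Given the past and the number of jumps, the residual
waiting time is exponential and the following waiting time is independent of it.
The parameter [theta] is tuned so that both parities give the same value. *)
Lemma refreshed_after_prob e s k (D : set T) : measurable (D : set (past X (clocks_before e
  k))) ->
  P (D `&` count_event e s k `&` refreshed_after_event e s k) =
    (refresh_prob%:E * P (D `&` count_event e s k))%E.
Proof.
move=> mD; pose D' := D `&` [set w | forall i, (i <= k)%N -> jump_time (clock_path e w) i <= s].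
have mD' : measurable (D' : set (past X (clocks_before e k))).
  apply: measurableI => //.
  exact: (measurable_jump_times_le (Y :=
    fun i (w : past X (clocks_before e k)) => clock_path e w i) s (@clock_past e k)).
have D's : D' `<=` [set w | jump_time (clock_path e w) k <= s] by move=> w [_]; apply.
pose N := [set w | s < jump_time (clock_path e w) k.+1].
have DN : D `&` count_event e s k = D' `&` N.
  by rewrite /count_event /jump_count /D' -setIA.
have mem x : 0 <= x -> P (D' `&` [set w | s + x < jump_time (clock_path e w) k.+1]) =
    ((expR (- (rate k * x)))%:E * P (D' `&` N))%E.
  by move=> x0; exact: residual_memoryless.
rewrite DN /refreshed_after_event /refreshed_after; case: (boolP (odd k)) => ok.
  rewrite (_ : _ `&` _ `&` _ = D' `&` [set w | s + theta < jump_time (clock_path e w) k.+1]);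
    last first.
    rewrite -setIA; congr (_ `&` _); apply/seteqP; split => w /= => [[]//|H]; split => //.
    by apply: le_lt_trans H; rewrite lerDl.
  by rewrite mem// /rate ok theta_prob.
have mDT : measurable D' := past_measurable mD'.
have PN : P (D' `&` N) \is a fin_num by rewrite fin_num_measure//; apply: measurableI => //;
  exact: measurable_jump_time_gt.
pose F i := D' `&` [set w | lands J h (clock_path e w) s k i].
have mF i : measurable (F i).
  by apply: measurableI => //; exact: (measurable_lands _ _ _ _ _ (clock_measurable e)).
have tF : trivIset setT F.
  apply/trivIsetP => i j _ _ ij; apply/seteqP;
    split => // w [[_ [/andP[i1 i2] _]] [_ [/andP[j1 j2] _]]].
  wlog lij : i j ij i1 i2 j1 j2 / (i < j)%N.
    move=> H; move: ij; rewrite neq_ltn => /orP[ij|ij]; [apply: (H i j)|apply: (H j i)] => //.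
      by rewrite neq_ltn ij.
    by rewrite neq_ltn ij.
  have := lt_le_trans j1 i2; rewrite ltrD2l ltNge => /negP; case.
  by rewrite ler_wpM2r// ler_nat.
rewrite (_ : _ `&` _ = \big[setU/set0]_(i < J) F i); last first.
  rewrite -(bigcup_mkord J F); apply/seteqP; split => w /=.
    by move=> [[Dw Nw] [i iJ li]]; exists i.
  move=> [i iJ [Dw li]]; split; last by exists i.
  split => //; case: li => /andP[+ _] _; apply: le_lt_trans; rewrite lerDl.
  by rewrite mulr_ge0.
have tFJ : trivIset [set: 'I_J] (fun i : 'I_J => F i).
  by apply/trivIsetP => i j _ _ ij; move/trivIsetP: tF; apply.
rewrite measure_semi_additive_ord//; last exact: bigsetU_measurable.
have FE (i : 'I_J) : P (F i) = ((expR (- (b * (i%:R * h))) * (1 - expR (- (b * h))) *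
     expR (- (a * ((J - i)%:R * h))))%:E * P (D' `&` N))%E.
  pose G := D' `&` [set w | s + i%:R * h < jump_time (clock_path e w) k.+1 <= s + i.+1%:R * h].
  have mS x : measurable ([set w | x < jump_time (clock_path e w) k.+1] : set (past X
    (clocks_before e k.+1))).
    by apply: measurable_ltset => //; exact: jump_time_past.
  have sub_past (A : set T) : measurable (A : set (past X (clocks_before e k))) ->
    measurable (A : set (past X (clocks_before e k.+1))).
    apply: smallest_sub; first exact: sigma_algebra_measurable.
    move=> _ [K [B [mB JQ ->]]]; apply: sub_sigma_algebra; exists K, B;
      split => // l /JQ [?|lk]; [by left|right].
    exact: ltnW.
  have GE : G = (D' `&` [set w | s + i%:R * h < jump_time (clock_path e w) k.+1]) `\`
                (D' `&` [set w | s + i.+1%:R * h < jump_time (clock_path e w) k.+1]).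
    apply/seteqP; split => w /=.
      by move=> [Dw /andP[h1 h2]]; split => // -[_]; rewrite ltNge h2.
    by move=> [[Dw h1] h2]; split => //; apply/andP; split => //; rewrite leNgt;
      apply/negP => h3; apply: h2.
  have mG : measurable (G : set (past X (clocks_before e k.+1))).
    by rewrite GE; apply: measurableD; apply: measurableI => //; exact: sub_past.
  have -> : F i = G `&` X (e, k.+1) @^-1` `](J - i)%:R * h, +oo[%classic.
    apply/seteqP; split => w /=; rewrite in_itv /= andbT; first by move=> [? []].
    by move=> [[? ?] ?].
  rewrite (past_independent indep (Q := clocks_before e k.+1)) //; last first.
    by case=> //=; rewrite ltnn.
  have -> : P (X (e, k.+1) @^-1` `](J - i)%:R * h, +oo[%classic) = (expR (- (a *
    ((J - i)%:R * h))))%:E.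
    apply: exponential_law_gt => //; first by rewrite mulr_ge0.
    by have := law e k.+1; rewrite /= ok.
  have mDx x : d.-measurable (D' `&` [set w | x < jump_time (clock_path e w) k.+1]).
    by apply: measurableI => //; exact: measurable_jump_time_gt.
  rewrite GE measureD//; last by rewrite -ge0_fin_numE// fin_num_measure.
  rewrite [X in (_ - P X)%E](_ : _ = D' `&` [set w | s + i.+1%:R *
    h < jump_time (clock_path e w) k.+1]); last first.
    apply/seteqP; split => w /= => [[_ ?]//|[Dw H]]; split => //; split => //.
    by apply: le_lt_trans H; rewrite lerD2l ler_wpM2r// ler_nat.
  rewrite /= !mem ?mulr_ge0// /rate (negPf ok) -(fineK PN).
  set z := fine _.
  have H : (expR (- (b * (i%:R * h))) * z - expR (- (b * (i.+1%:R * h))) * z) *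
      expR (- (a * ((J - i)%:R * h))) =
      expR (- (b * (i%:R * h))) * (1 - expR (- (b * h))) * expR (- (a * ((J - i)%:R * h))) * z.
    have -> : expR (- (b * (i.+1%:R * h))) = expR (- (b * (i%:R * h))) * expR (- (b * h)).
      by rewrite -expRD; congr expR; rewrite -natr1; ring.
    ring.
  exact: (congr1 EFin H).
rewrite /=; under eq_bigr do rewrite FE -(fineK PN) -EFinM.
rewrite sumEFin -(fineK PN) -EFinM -mulr_suml; congr (_ * _)%:E.
by rewrite /refresh_prob mulr_sumr; apply: eq_bigr => i _; ring.
Qed.

End Refresh.

(** * Total count and histories *)

Section Count.
Context d (T : measurableType d) (R : realType) (P : probability T R).
Variables (E : finType) (X : E * nat -> {RV P >-> R}) (a b : R).
Hypotheses (a0 : 0 < a) (b0 : 0 < b).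
Hypothesis indep : mutually_independent X.
Hypothesis law : forall e k, has_exponential_law (X (e, k)) (if odd k then a else b).

(** The rates take two values only, so each factor is at most a constant below 1. *)
Lemma clocks_le_prob e s K : 0 <= s ->
  (P (\big[setI/setT]_(i < K) (X (e, nat_of_ord i) @^-1` `]-oo, s]%classic))
     <= ((1 - expR (- (Num.max a b * s))) ^+ K)%:E)%E.
Proof.
move=> s0; elim: K => [|K IH]; first by rewrite big_ord0 probability_setT.
rewrite big_ord_recr /=.
rewrite (past_independent indep (Q := clocks_before e K)) //; last 2 first.
  by case=> //=; rewrite ltnn.
  apply: (big_ind (fun A : set T => measurable (A : set (past X (clocks_before e K)))));
    [exact: measurableT|by move=> *; exact: measurableI|move=> i _].
  rewrite -[X in measurable X]setTI; apply: (measurable_past (X := X)) => //.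
  by right => /=.
have -> : P (X (e, K) @^-1` `]-oo, s]%classic) = (1 - (expR (- (rate a b K * s)))%:E)%E.
  exact: (exponential_law_le (rate_gt0 a0 b0 K) s0 (law e K)).
rewrite exprSr EFinM; apply: lee_pmul => //.
  rewrite -EFinB lee_fin subr_ge0 -expR0 ler_expR oppr_le0 mulr_ge0//.
  by rewrite ltW// rate_gt0.
rewrite -EFinB lee_fin lerD2l lerN2 ler_expR lerN2 ler_wpM2r// /rate.
by case: ifP => _; rewrite le_max lexx ?orbT.
Qed.

(** If all jump times stayed below [s], then all waiting times would, apart from the
null event that one of them is negative; this has probability 0 by
[clocks_le_prob]. *)
Lemma count_event_total e s : 0 <= s -> P (\bigcup_k count_event X e s k) = 1%E.
Proof.
move=> s0.
have mU : measurable (\bigcup_k count_event X e s k).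
  by apply: bigcup_measurable => k _; exact: measurable_count_event.
suff : P (~` \bigcup_k count_event X e s k) = 0%E.
  by rewrite probability_setC// => /eqP; rewrite sube_eq ?fin_num_measure// add0e => /eqP ->.
pose Z := \bigcup_k (X (e, k) @^-1` `]-oo, 0[%classic).
have mZ k : measurable (X (e, k) @^-1` `]-oo, 0[%classic).
  by rewrite -[X in measurable X]setTI; apply: measurable_funPT.
have mZU : measurable Z by exact: bigcup_measurable.
have Z0 : P Z = 0%E.
  apply/eqP; rewrite -measure_le0.
  apply: le_trans (measure_sigma_subadditive P mZ mZU (fun _ => id)) _.
  rewrite eseries0//= => k _ _; exact: (exponential_law_neg (law e k)).
pose c := 1 - expR (- (Num.max a b * s)).
have m0 : 0 < Num.max a b by rewrite lt_max a0.
have c0 : 0 <= c by rewrite subr_ge0 -expR0 ler_expR oppr_le0 mulr_ge0// ltW.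
have c1 : c < 1 by rewrite ltrBlDr ltrDl expR_gt0.
have bound K : (P (~` \bigcup_k count_event X e s k) <= (c ^+ K)%:E)%E.
  pose C := \big[setI/setT]_(i < K) (X (e, nat_of_ord i) @^-1` `]-oo, s]%classic).
  have mC : measurable C.
    apply: (big_ind (fun A : set T => measurable A)) => // [A B|i _]; first exact: measurableI.
    by rewrite -[X in measurable X]setTI; apply: measurable_funPT.
  apply: (@le_trans _ _ (P (Z `|` C))).
    apply: le_measure; rewrite ?inE//; [exact: measurableC|exact: measurableU|].
    move=> w nw; case: (pselect (Z w)) => [|nZ]; [by left|right].
    have pos k : 0 <= X (e, k) w.
      by rewrite leNgt; apply/negP => neg; apply: nZ; exists k => //=.
    have js k : jump_time (clock_path X e w) k <= s.
      rewrite leNgt; apply/negP => sk; apply: nw.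
      have exk : exists k, s < jump_time (clock_path X e w) k by exists k.
      case: (ex_minnP exk) => -[|m] sm minm.
        by move: sm; rewrite /jump_time big_ord0 ltNge s0.
      exists m => //; split => // i im; rewrite leNgt; apply/negP => /minm.
      by rewrite ltnNge im.
    rewrite /C -(bigcap_mkord K (fun i => X (e, i) @^-1` `]-oo, s]%classic)) => i _ /=.
    rewrite in_itv /=; apply: le_trans (js i.+1).
    by rewrite jump_timeS lerDr; apply: sumr_ge0 => j _; exact: pos.
  apply: le_trans (measureU2 _ _ _) _ => //.
  by rewrite [X in (X + _)%E]Z0 add0e; exact: clocks_le_prob.
apply/eqP; rewrite eq_le measure_ge0 andbT.
apply/lee_addgt0Pr => eps eps0; rewrite add0e.
have /cvgrPdist_lt /(_ _ eps0) [K _ /(_ K (leqnn _))] : (c ^+ n @[n --> \oo] --> (0 : R)).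
  by apply: cvg_expr; rewrite ger0_norm.
rewrite /= sub0r normrN ger0_norm ?exprn_ge0// => cK.
by apply: le_trans (bound K) _; rewrite lee_fin ltW.
Qed.

End Count.

Section History.
Context d (T : measurableType d) (R : realType) (P : probability T R).
Variables (E : finType) (X : E * nat -> {RV P >-> R}).

(** The events [H] known at time [s] as far as [e] is concerned: on the event that
[e] has jumped exactly [k] times before [s], [H] depends only on the first [k]
clocks of [e] and on the clocks of the other pairs. *)
Definition history e s (H : set T) := measurable H /\
  forall k, exists2 D : set T, measurable (D : set (past X (clocks_before e k))) &
     H `&` count_event X e s k = D `&` count_event X e s k.

Lemma historyT e s : history e s setT.
Proof. by split=> // k; exists setT => //; exact: measurableT. Qed.

Lemma historyC e s H : history e s H -> history e s (~` H).
Proof.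
move=> [mH HD]; split; first exact: measurableC.
move=> k; have [D mD DE] := HD k; exists (~` D);
  first exact: (@measurableC _ (past X (clocks_before e k))).
apply/seteqP; split => w [Hw cw]; split => // Hw'; apply: Hw.
  by have : (D `&` count_event X e s k) w by []; rewrite -DE => -[].
by have : (H `&` count_event X e s k) w by []; rewrite DE => -[].
Qed.

Lemma historyI e s H H' : history e s H -> history e s H' -> history e s (H `&` H').
Proof.
move=> [mH HD] [mH' HD']; split; first exact: measurableI.
move=> k; have [D mD DE] := HD k; have [D' mD' DE'] := HD' k.
exists (D `&` D'); first exact: measurableI.
by rewrite setIIl DE DE' -setIIl.
Qed.

Lemma history_bigsetI e s (I : Type) (l : seq I) (Q : pred I) (H : I -> set T) :
  (forall i, Q i -> history e s (H i)) -> history e s (\big[setI/setT]_(i <- l | Q i) H i).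
Proof. by move=> HH; apply: big_ind HH; [exact: historyT|exact: historyI]. Qed.

Lemma history_bigsetU e s (I : Type) (l : seq I) (Q : pred I) (H : I -> set T) :
  (forall i, Q i -> history e s (H i)) -> history e s (\big[setU/set0]_(i <- l | Q i) H i).
Proof.
move=> HH; apply: big_ind HH; first by rewrite -setCT; exact/historyC/historyT.
by move=> A B hA hB; rewrite -(setCK (A `|` B)) setCU;
  exact/historyC/historyI/historyC/hB/historyC.
Qed.

Variables (J : nat) (h theta D : R).
Hypotheses (h0 : 0 <= h) (thD : theta <= D) (JD : J.+1%:R * h <= D).

Lemma refresh_history_other e e' s s' : e' != e ->
  history e s (refresh_event X J h theta e' s').
Proof.
move=> ee; split; first exact: measurable_refresh_event.
move=> k; exists (refresh_event X J h theta e' s') => //.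
apply: (measurable_refreshed (Y :=
  fun i (w : past X (clocks_before e k)) => clock_path X e' w i)) => i.
by apply: measurable_past; left; apply/eqP.
Qed.

(** On the event that [e] has jumped [k] times before [s], the clocks of [e] from
[k] on can be replaced by one waiting time that ends at [s + 1]: by
[refreshed_past] this does not change whether [e] is refreshed at time [s']. *)
Lemma refresh_history_earlier e s s' : s' + D <= s ->
  history e s (refresh_event X J h theta e s').
Proof.
move=> ss; split; first exact: measurable_refresh_event.
(* with these waiting times the jump [k.+1] is at time [s + 1] *)
move=> k; pose Y i (w : past X (clocks_before e k)) : R :=
  if (i < k)%N then clock_path X e w i else s + 1 - jump_time (clock_path X e w) k.
have YE w i : (i < k)%N -> clock_path X e w i = Y i w by rewrite /Y => ->.
exists [set w | refreshed J h theta (Y^~ w) s'].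
  apply: measurable_refreshed => i; rewrite /Y; case: (ltnP i k) => ik.
    exact: clock_past.
  by apply: measurable_funB => //; exact: jump_time_past.
have YS w : jump_time (Y^~ w) k.+1 = s + 1.
  rewrite jump_timeS -(eq_jump_time (YE w) (leqnn _)) /Y ltnn; ring.
have lt1 w : s' + D < jump_time (Y^~ w) k.+1 by rewrite YS; lra.
have lt2 w : count_event X e s k w -> s' + D < jump_time (clock_path X e w) k.+1.
  by case=> _; exact: le_lt_trans.
apply/seteqP; split => w [rw cw]; split => //.
  exact: (refreshed_past h0 thD JD (YE w) (lt2 w cw) (lt1 w)).
apply: (refreshed_past h0 thD JD _ (lt1 w) (lt2 w cw) rw) => i ik.
by rewrite YE.
Qed.

End History.

(** * Independent snapshots *)

Section RefreshIndependence.
Context d (T : measurableType d) (R : realType) (P : probability T R).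
Variables (E : finType) (X : E * nat -> {RV P >-> R}) (a b : R).
Hypotheses (a0 : 0 < a) (b0 : 0 < b).
Hypothesis indep : mutually_independent X.
Hypothesis law : forall e k, has_exponential_law (X (e, k)) (if odd k then a else b).
Variables (J : nat) (h theta D : R).
Hypotheses (h0 : 0 <= h) (th0 : 0 <= theta) (thD : theta <= D) (JD : J.+1%:R * h <= D).
Local Notation p := (refresh_prob a b J h).
Hypothesis theta_prob : expR (- (a * theta)) = p.
Hypothesis p01 : 0 <= p <= 1.

(** Almost surely the number of jumps before [s] is finite, and it is unique. *)
Lemma count_decomposition e s (A : set T) : 0 <= s -> measurable A ->
  P A = (\sum_(k <oo) P (A `&` count_event X e s k))%E.
Proof.
move=> s0 mA; have mc k := measurable_count_event X e s k.
have mU : measurable (\bigcup_k count_event X e s k) by exact: bigcup_measurable.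
transitivity (P (A `&` \bigcup_k count_event X e s k)).
  rewrite -[in LHS](setIT A) -[in LHS](setUv (\bigcup_k count_event X e s k)) setIUr measureU.
  - rewrite [X in (_ + X)%E](_ : _ = 0%E) ?adde0//.
    apply/eqP; rewrite -measure_le0;
      apply: (@le_trans _ _ (P (~` \bigcup_k count_event X e s k))).
      by apply: le_measure; rewrite ?inE//; [apply: measurableI => //|]; exact: measurableC.
    by rewrite probability_setC// (count_event_total a0 b0 indep law e s0) subee.
  - exact: measurableI.
  - by apply: measurableI => //; exact: measurableC.
  - by rewrite setIACA setICr setI0.
rewrite setI_bigcupr measure_semi_bigcup//.
- by move=> k; exact: measurableI.
- apply/trivIsetP => i j _ _ ij; apply/seteqP; split => // w [[_ ci] [_ cj]].
  by move: ij; rewrite (jump_count_inj ci cj) eqxx.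
- by apply: bigcup_measurable => k _; exact: measurableI.
Qed.

(** Sum [refreshed_after_prob] over the number of jumps of [e] before [s]. *)
Lemma refresh_history_indep e s (H : set T) : 0 <= s -> history X e s H ->
  P (H `&` refresh_event X J h theta e s) = (p%:E * P H)%E.
Proof.
move=> s0 [mH HD]; have mr := measurable_refresh_event X J h theta e s.
rewrite (count_decomposition e s0 (measurableI _ _ mH mr)) (count_decomposition e s0 mH).
rewrite -nneseriesZl//; apply: eq_eseriesr => k _.
have [A mA AE] := HD k; rewrite AE.
rewrite -(refreshed_after_prob a0 b0 indep law h0 th0 theta_prob)//.
congr (P _); apply/seteqP; split => w.
  move=> [[Hw [k' [ck' gk']]] ck]; have kk := jump_count_inj ck' ck; subst k'.
  have : (H `&` count_event X e s k) w by [].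
  by rewrite AE.
move=> [[Aw ck] gk]; have : (A `&` count_event X e s k) w by [].
by rewrite -AE => -[Hw _]; do 2 split => //; exists k.
Qed.

Definition state_event j (g : {set E}) e : set T :=
  if e \in g then refresh_event X J h theta e (j%:R * D)
  else ~` refresh_event X J h theta e (j%:R * D).

Lemma spacing_ge0 : 0 <= D. Proof. exact: le_trans thD. Qed.

Lemma state_history j j' g e e' : e' != e \/ (j < j')%N ->
  history X e (j'%:R * D) (state_event j g e').
Proof.
move=> ee; suff : history X e (j'%:R * D) (refresh_event X J h theta e' (j%:R * D)).
  by move=> H; rewrite /state_event; case: ifP => // _; exact: historyC.
have [e'e|e'e] := eqVneq e' e; last exact: refresh_history_other.
rewrite e'e in ee *; apply: (refresh_history_earlier _ h0 thD JD); move: ee; case=> [|jj];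
  first by rewrite eqxx.
by rewrite -[X in _ + X]mul1r -mulrDl natr1 ler_wpM2r ?spacing_ge0// ler_nat.
Qed.

(** Reveal the pairs one after the other: what is known of the pairs already
revealed belongs to the history of the next one. *)
Lemma states_prob j g (H : set T) (l : seq E) :
  (forall e, history X e (j%:R * D) H) -> uniq l ->
  P (H `&` \big[setI/setT]_(e <- l) state_event j g e) =
    ((\prod_(e <- l) (if e \in g then p else 1 - p))%:E * P H)%E.
Proof.
move=> HH; elim: l => [|e l IH]; first by rewrite !big_nil setIT mul1e.
move=> /= /andP[el ul]; rewrite !big_cons setIC -setIA [X in _ `&` X]setIC setIC.
set H' := H `&` _ in IH *.
have hH' : history X e (j%:R * D) H'.
  apply: historyI => //; rewrite big_seq; apply: history_bigsetI => e' e'l.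
  by apply: state_history; left; apply: contraNneq el => <-.
have jD : 0 <= j%:R * D by rewrite mulr_ge0 ?spacing_ge0.
have PR := refresh_history_indep jD hH'.
have mr : measurable (refresh_event X J h theta e (j%:R * D)) by exact: measurable_refresh_event.
have [mH' _] := hH'.
rewrite EFinM -muleA -IH// /state_event; case: ifP => _ //.
rewrite -setDE measureD//=; last by rewrite -ge0_fin_numE// fin_num_measure.
by rewrite PR EFinB muleBl ?mul1e// fin_num_measure.
Qed.

Definition snapshot j w : {set E} :=
  [set e | `[< refreshed J h theta (clock_path X e w) (j%:R * D) >]]%SET.

Lemma snapshot_event j g :
  [set w | snapshot j w = g] = \big[setI/setT]_(e <- index_enum E) state_event j g e.
Proof.
apply/seteqP; split => w /=.
  move=> <-; apply: (big_ind (fun A : set T => A w)) => // e _.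
  by rewrite /state_event inE; case: asboolP.
move=> H; apply/setP => e; rewrite inE.
have : state_event j g e w.
  have : e \in index_enum E by rewrite mem_index_enum.
  elim: (index_enum E) H => // e' l IH; rewrite big_cons inE => -[He' Hl] /predU1P[->//|].
  exact: IH.
by rewrite /state_event; case: ifP => _ H'; apply/asboolP.
Qed.

Variable A : pred {set E}.

Definition failures m : set T :=
  \big[setI/setT]_(j < m) \big[setU/set0]_(g | ~~ A g) [set w | snapshot j w = g].

Lemma failuresP m w : failures m w <-> forall j, (j < m)%N -> ~~ A (snapshot j w).
Proof.
split.
  elim: m => [//|m IH]; rewrite /failures big_ord_recr /= => -[/IH {}IH Hm] j.
  rewrite ltnS leq_eqVlt => /predU1P[->|/IH//].
  apply: (big_ind (fun B : set T => B w -> ~~ A (snapshot m w)) _ _ _ Hm) => //.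
    by move=> B C HB HC [/HB|/HC].
  by move=> g Ag /= ->.
move=> H; apply: (big_ind (fun B : set T => B w)) => // j _.
have := H j (ltn_ord j) => Aj.
by rewrite (bigD1 (snapshot j w))//=; left.
Qed.

Lemma failures_history m e j : (m <= j)%N -> history X e (j%:R * D) (failures m).
Proof.
move=> mj; apply: history_bigsetI => i _; apply: history_bigsetU => g _.
rewrite snapshot_event; apply: history_bigsetI => e' _; apply: state_history; right.
exact: leq_trans mj.
Qed.

Lemma snapshot_bigsetU j (H : set T) (l : seq {set E}) (Q : pred {set E}) :
  (forall e, history X e (j%:R * D) H) -> measurable H -> uniq l ->
  P (H `&` \big[setU/set0]_(g <- l | Q g) [set w | snapshot j w = g]) =
    ((\sum_(g <- l | Q g) subset_prob p g)%:E * P H)%E.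
Proof.
move=> HH mH; have ms g : measurable [set w | snapshot j w = g].
  rewrite snapshot_event; apply: (big_ind measurable) => // [B C|e _]; first exact: measurableI.
  by rewrite /state_event; case: ifP => _; [|apply: measurableC]; exact: measurable_refresh_event.
elim: l => [|g l IH]; first by rewrite !big_nil setI0 measure0 mul0e.
move=> /= /andP[gl ul]; rewrite !big_cons; case: ifP => Qg; last exact: IH.
have mU : measurable (\big[setU/set0]_(g <- l | Q g) [set w | snapshot j w = g]).
  by apply: bigsetU_measurable.
rewrite setIUr measureU/=; [|exact: measurableI|exact: measurableI|]; last first.
  apply/seteqP; split => // w /= [[_ wg] [_]].
  rewrite big_seq_cond => Hw; suff : g \in l by rewrite (negPf gl).
  move: Hw; apply: (big_ind (fun B : set T => B w -> g \in l)) => // [B C HB HC [/HB|/HC]//|g'].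
  by rewrite /= => /andP[g'l _]; rewrite wg => ->.
rewrite EFinD ge0_muleDl ?lee_fin ?subset_prob_ge0//; last first.
  by apply: sumr_ge0 => g' _; exact: subset_prob_ge0.
congr (_ + _)%E; last exact: IH.
by rewrite snapshot_event states_prob// index_enum_uniq.
Qed.

(** Given the first attempts, the next snapshot has the law [subset_prob p], so the
attempts are independent. *)
Lemma failures_prob m :
  P (failures m) = ((1 - \sum_(g | A g) subset_prob p g) ^+ m)%:E.
Proof.
elim: m => [|m IH]; first by rewrite /failures big_ord0 probability_setT.
rewrite /failures big_ord_recr /= -/(failures m) snapshot_bigsetU//; last 3 first.
- by move=> e; exact: failures_history.
- by apply: (big_ind measurable) => // [B C|j _]; [exact: measurableI|];
    apply: bigsetU_measurable => g _; rewrite snapshot_event;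
    apply: (big_ind measurable) => // [B C|e _]; [exact: measurableI|];
    rewrite /state_event; case: ifP => _; [|apply: measurableC]; exact: measurable_refresh_event.
- exact: index_enum_uniq.
rewrite IH -EFinM exprS; congr (_ * _)%:E.
by rewrite -(sum_subset_prob E p) [X in _ = X - _](bigID A) /= [RHS]addrC addKr.
Qed.

End RefreshIndependence.

(** * Geometric waiting time for a large component *)

Section Waiting.
Context d (T : measurableType d) (R : realType) (P : probability T R).

(** Hitting times are not known to be measurable, so monotonicity of the integral is
derived from its definition as a supremum over simple functions. *)
Lemma ge0_le_integralT (f g : T -> \bar R) :
  (forall w, 0 <= f w)%E -> (forall w, f w <= g w)%E ->
  (\int[P]_w f w <= \int[P]_w g w)%E.
Proof.
move=> f0 fg; have g0 w : (0 <= g w)%E by apply: le_trans (fg w).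
rewrite !ge0_integralTE//; apply: ereal_sup_le => _ [k kf <-]; exists k => //.
by move=> w; apply: le_trans (fg w).
Qed.

(** The waiting time is at most [D] times the number of attempts, that is, the sum
of [D] over the indices [m] such that the first [m] attempts fail.  On the event
that all attempts fail that sum is infinite, so the bound holds everywhere. *)
Lemma geometric_waiting (F : nat -> set T) (tau : T -> \bar R) (D q : R) :
  0 < D -> 0 < q <= 1 -> (forall m, measurable (F m)) ->
  (forall m, P (F m) = ((1 - q) ^+ m)%:E) ->
  (forall w, 0 <= tau w)%E ->
  (forall w m, F m w -> ~ F m.+1 w -> (tau w <= (m.+1%:R * D)%:E)%E) ->
  (forall w m m', (m' <= m)%N -> F m w -> F m' w) -> (forall w, F 0%N w) ->
  (\int[P]_w tau w <= (D / q)%:E)%E.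
Proof.
move=> D0 /andP[q0 q1] mF PF tau0 tauF Fdec F0.
pose g w := (\sum_(m <oo) (D%:E * (\1_(F m) w)%:E))%E.
have f0 m w : (0 <= D%:E * (\1_(F m) w)%:E :> \bar R)%E.
  by rewrite -EFinM lee_fin mulr_ge0// ltW.
have gN N w : (forall m, (m < N)%N -> F m w) -> ((N%:R * D)%:E <= g w)%E.
  move=> H; apply: le_trans (nneseries_lim_ge N _); last by [].
  rewrite big_mkord (eq_bigr (fun=> D%:E)); last first.
    by move=> i _; rewrite indicE mem_set ?mule1//; exact: H.
  by rewrite sumEFin sumr_const card_ord lee_fin mulr_natl.
apply: (@le_trans _ _ (\int[P]_w g w)%E).
  apply: ge0_le_integralT => // w.
  have [allF|] := pselect (forall m, F m w).
    case E : (g w) => [r| |]; [|exact: leey|].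
      have := gN (Num.truncn (r / D)).+1 w (fun m _ => allF m).
      rewrite E lee_fin -ler_pdivlMr// leNgt; case/negP.
      exact: truncnS_gt.
    have := gN 0%N w (fun m _ => allF m); rewrite E mul0r.
    by rewrite leeNy_eq.
  move=> /existsNP exF.
  have exF' : exists m, ~~ `[< F m w >] by case: exF => m nF; exists m; apply/asboolPn.
  case: (ex_minnP exF') => -[|m] /asboolPn nF minF; first by case: nF.
  have Fm k : (k <= m)%N -> F k w.
    move=> km; apply: contrapT => nFk; suff : (m < k)%N by rewrite ltnNge km.
    by apply: minF; apply/asboolPn.
  by apply: le_trans (tauF w m (Fm m (leqnn _)) nF) _; apply: gN => k; exact: Fm.
rewrite integral_nneseries//; last first.
  by move=> m; apply: measurable_funeM; apply/measurable_EFinP; exact: measurable_indic.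
apply: lime_le.
  by apply: is_cvg_nneseries => m _ _; exact: integral_ge0.
near=> N; rewrite big_mkord.
rewrite (eq_bigr (fun m : 'I_N => (D * (1 - q) ^+ m)%:E)); last first.
  move=> m _; rewrite ge0_integralZl_EFin//; last 2 first.
  - by apply/measurable_EFinP; exact: measurable_indic.
  - exact: ltW.
  by rewrite integral_indic// setIT /= PF -EFinM.
rewrite sumEFin lee_fin -mulr_sumr ler_pM2l//.
have -> : \sum_(i < N) (1 - q) ^+ i = (1 - (1 - q) ^+ N) / q.
  apply: (mulIf (lt0r_neq0 q0)); rewrite divfK ?lt0r_neq0//.
  have := subrX1 (1 - q) N; rewrite addrAC subrr add0r mulNr => H.
  by rewrite mulrC -[RHS]opprB H opprK.
by rewrite ler_pdivrMr// mulVf ?lt0r_neq0// gerBl exprn_ge0// subr_ge0.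
Unshelve. all: by end_near. Qed.

End Waiting.

Section GraphMonotone.
Variable n : nat.
Implicit Types g : graph n.

Lemma has_big_component_sub k g g' : g \subset g' -> has_big_component k g ->
  has_big_component k g'.
Proof.
move=> gg /existsP[v kv]; apply/existsP; exists v; apply: leq_trans kv _.
apply/subset_leq_card/fintype.subsetP => u; rewrite !inE.
apply: connect_sub => x y /existsP[e /andP[eg E]].
apply/connect1/existsP; exists e; rewrite E andbT.
exact: (fintype.subsetP gg).
Qed.

End GraphMonotone.

Section HittingTime.
Context d (T : measurableType d) (R : realType) (P : probability T R).
Variables (alpha : R) (n : nat) (X : vertex_pair n * nat -> {RV P >-> R}).
Hypotheses (alpha0 : 0 < alpha) (n2 : (2 <= n)%N).
Hypothesis clk : dynamic_ER_clocks alpha alpha (empty_graph n) X.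
Variables (J : nat) (h theta : R).
Local Notation b := (alpha / (n%:R - 1)).
Local Notation p := (refresh_prob alpha b J h).
Hypotheses (h0 : 0 < h) (thJ : J%:R * h <= theta).
Hypothesis theta_prob : expR (- (alpha * theta)) = p.
Hypothesis p01 : 0 <= p <= 1.

(** A snapshot is a subgraph of the dynamic graph at time [J * h] after the attempt,
and adding edges only enlarges components. *)
Lemma hitting_time_bound (x : R) k : x <= k%:R -> 0 < big_component_prob n p k ->
  (\int[P]_w tau_hat (empty_graph n) X x w
     <= ((theta + J.+1%:R * h) / big_component_prob n p k)%:E)%E.
Proof.
move=> xk q0; have [indep law0] := clk.
have n1 : 0 < n%:R - 1 :> R by rewrite subr_gt0 ltr1n.
have b0 : 0 < b by rewrite divr_gt0.
have law e i : has_exponential_law (X (e, i)) (if odd i then alpha else b).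
  by have := law0 e i; rewrite /pair_state finset.in_set0.
have th0 : 0 <= theta by apply: le_trans thJ; rewrite mulr_ge0// ltW.
have Jh0 : 0 < J.+1%:R * h by rewrite mulr_gt0.
set D := theta + J.+1%:R * h.
have D0 : 0 < D by rewrite ltr_wpDl.
have thD : theta <= D by rewrite lerDl ltW.
have JD : J.+1%:R * h <= D by rewrite lerDr.
pose A : pred {set vertex_pair n} := has_big_component k.
pose F := failures X J h theta D A.
have FP := @failuresP _ _ _ _ _ X J h theta D A.
have mF m : measurable (F m).
  (* a pair is needed only to speak of a history *)
  have e0 : vertex_pair n.
    exists [set Ordinal (ltn_trans (ltnSn 0) n2); Ordinal n2]%SET; by rewrite cards2.
  by have [] := failures_history X (ltW h0) th0 thD JD A e0 (leqnn m).
have q1 : big_component_prob n p k <= 1.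
  rewrite -[leRHS](sum_subset_prob (vertex_pair n) p) [leRHS](bigID (has_big_component k)) /=
    -/(big_component_prob n p k) lerDl.
  by apply: sumr_ge0 => g _; exact: subset_prob_ge0.
apply: (@geometric_waiting _ _ _ _ F) => //.
- by rewrite q0.
- move=> m; exact: (failures_prob alpha0 b0 indep law (ltW h0) th0 thD JD theta_prob p01 A m).
- by move=> w; apply: le_ereal_inf_tmp => _ [t [t0 _] <-]; rewrite lee_fin.
- move=> w m Fm nF.
  have Am : A (snapshot X J h theta D m w).
    apply: contrapT => nA; apply: nF; apply/FP => j; rewrite ltnS leq_eqVlt.
    move=> /predU1P[->|jm]; first exact/negP.
    by have /FP := Fm; apply.
  pose t := m%:R * D + J%:R * h.
  have t0 : 0 <= t by rewrite addr_ge0// mulr_ge0// ltW.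
  apply: (@le_trans _ _ t%:E); last first.
    rewrite lee_fin -natr1 mulrDl mul1r lerD2l; apply: le_trans JD.
    by rewrite ler_wpM2r ?ler_nat// ltW.
  apply: ereal_inf_lbound; exists t => //; split => //.
  have : has_big_component k (dynamic_ER_graph (empty_graph n) X t w).
    apply: has_big_component_sub Am; apply/fintype.subsetP => e; rewrite inE => /asboolP.
    move=> /(refreshed_on (ltW h0) th0 thJ)[i oi ji]; rewrite inE; apply/asboolP.
    by exists i; split => //; rewrite /pair_state finset.in_set0.
  by move=> /existsP[v kv]; exists v; apply: le_trans xk _; rewrite ler_nat.
- by move=> w m m' mm /FP H; apply/FP => j jm; apply: H; exact: leq_trans mm.
- by move=> w; apply/FP.
Qed.

End HittingTime.

(** * Choice of the parameters *)

Section RefreshProb.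
Variables (R : realType) (a h : R) (J : nat).
Hypotheses (a0 : 0 < a) (h0 : 0 < h).
Let r := expR (- (a * h)).
Let G := \sum_(i < J) r ^+ (J - i).

Lemma decay_pow i : expR (- (a * (i%:R * h))) = r ^+ i.
Proof. by rewrite /r -expRM_natl; congr expR; ring. Qed.

Lemma decay_sum : (1 - r) * G = r * (1 - r ^+ J).
Proof.
rewrite /G; elim: J => [|k IH]; first by rewrite big_ord0 expr0 subrr !mulr0.
rewrite big_ord_recl /= subn0.
rewrite (eq_bigr (fun i : 'I_k => r ^+ (k - i))); last by move=> i _; rewrite subSS.
by rewrite mulrDr IH exprS; ring.
Qed.

(** Below its continuous counterpart: [a * h * r <= 1 - r] for [r = exp (- a * h)]. *)
Lemma decay_sum_upper : a * h * G <= 1 - r ^+ J.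
Proof.
have ah : 0 < a * h by rewrite mulr_gt0.
have r0 : 0 < r by exact: expR_gt0.
have r1 : r < 1 by rewrite expR_lt1 oppr_lt0.
have rJ : 0 <= 1 - r ^+ J by rewrite subr_ge0 exprn_ile1// ltW.
rewrite -(ler_pM2l (x := 1 - r)) ?subr_gt0// mulrCA decay_sum mulrA.
rewrite ler_wpM2r// lerBrDr (_ : _ + _ = (1 + a * h) * r); last by ring.
by rewrite -ler_pdivlMr// div1r /r expRN invrK expR_ge1Dx.
Qed.

Lemma decay_sum_lower : r * (1 - r ^+ J) <= a * h * G.
Proof.
rewrite -decay_sum ler_wpM2r//; first by apply: sumr_ge0 => i _; rewrite exprn_ge0// expR_ge0.
by rewrite lerBlDl -lerBlDr addrC; have := expR_ge1Dx (- (a * h)); rewrite addrC.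
Qed.

(** The slots form a lower Riemann sum for the integral of [b * exp (- a * (t - u))]
over [0 <= u <= t], where [t = J * h]. *)
Lemma refresh_prob_upper b : 0 < b -> refresh_prob a b J h <= b / a * (1 - r ^+ J).
Proof.
move=> b0; have G0 : 0 <= G by apply: sumr_ge0 => i _; rewrite exprn_ge0// expR_ge0.
apply: (@le_trans _ _ (b / a * (a * h * G))); last first.
  by rewrite ler_wpM2l ?decay_sum_upper// divr_ge0// ltW.
rewrite (_ : b / a * (a * h * G) = (b * h) * G); last by field; rewrite gt_eqF.
rewrite /refresh_prob; apply: ler_pM.
- by rewrite subr_ge0 -expR0 ler_expR oppr_le0 mulr_ge0// ltW.
- by apply: sumr_ge0 => i _; rewrite mulr_ge0// expR_ge0.
- by rewrite lerBlDr -lerBlDl; have := expR_ge1Dx (- (b * h)).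
apply: ler_sum => i _; rewrite decay_pow ler_piMl// ?exprn_ge0 ?expR_ge0//.
by rewrite -expR0 ler_expR oppr_le0 mulr_ge0 ?mulr_ge0// ltW.
Qed.

Lemma refresh_prob_lower b : 0 < b ->
  b / a * (expR (- (b * (J.+1%:R * h))) * (r * (1 - r ^+ J))) <= refresh_prob a b J h.
Proof.
move=> b0; have G0 : 0 <= G by apply: sumr_ge0 => i _; rewrite exprn_ge0// expR_ge0.
apply: (@le_trans _ _ (b / a * (expR (- (b * (J.+1%:R * h))) * (a * h * G)))).
  rewrite ler_wpM2l ?divr_ge0 ?(ltW a0) ?(ltW b0)//.
  by rewrite ler_wpM2l ?expR_ge0// decay_sum_lower.
rewrite (_ : b / a * _ = (b * h * expR (- (b * h))) * (expR (- (b * (J%:R * h))) * G));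
  last first.
  rewrite -natr1 mulrDl mul1r mulrDr opprD expRD; field; by rewrite gt_eqF.
rewrite /refresh_prob; apply: ler_pM.
- by rewrite !mulr_ge0 ?expR_ge0// ltW.
- by rewrite mulr_ge0 ?expR_ge0.
- have := ler_wpM2r (expR_ge0 (- (b * h))) (expR_ge1Dx (b * h)).
  by rewrite -expRD subrr expR0 mulrDl mul1r; lra.
rewrite mulr_sumr; apply: ler_sum => i _; rewrite decay_pow ler_wpM2r ?exprn_ge0 ?expR_ge0//.
rewrite ler_expR lerN2 ler_wpM2l ?(ltW b0)// ler_wpM2r ?(ltW h0)// ler_nat.
exact: ltnW.
Qed.

End RefreshProb.

Section RefreshProbNear.
Variable R : realType.

(** As [n] grows the rate of appearance [b] tends to 0, so that [n * p] tends to
[a * h * r * (1 - r ^ J) / (1 - r)] up to a factor at most 1; with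
[a * h = delta / 4] and [J >= 16 / delta ^ 2] each of the three factors lost is
at least [1 - delta / 4].  The upper bound [1 / n] needs [r ^ J >= 1 / n] only.
The last inequality says that [theta] covers the slots. *)
Lemma refresh_prob_near (a delta : R) : 0 < a -> 0 < delta <= 1 / 2 ->
  exists J h, 0 < h /\ exists N0 : nat, forall n : nat, (N0 <= n)%N -> (2 <= n)%N ->
    let p := refresh_prob a (a / (n%:R - 1)) J h in
    1 - delta <= n%:R * p /\ n%:R * p <= 1 /\ p <= expR (- (a * (J%:R * h))).
Proof.
move=> a0 /andP[d0 d1].
pose h := delta / 4 / a.
pose J := (Num.truncn (16 / delta ^+ 2)).+1.
have h0 : 0 < h by rewrite !divr_gt0.
have ah : a * h = delta / 4 by rewrite /h; field; rewrite gt_eqF.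
have JB : 16 / delta ^+ 2 < J%:R by exact: truncnS_gt.
exists J, h; split => //.
exists (maxn J.+2 (Num.truncn (expR (a * (J%:R * h)))).+1) => n.
rewrite geq_max => /andP[nJ nE] n2.
have n1 : 1 <= n%:R - 1 :> R by rewrite lerBrDr; apply: (@le_trans _ _ 2); rewrite ?ler_nat.

have n0 : 0 < n%:R :> R by lra.
set b := a / (n%:R - 1); have b0 : 0 < b by rewrite divr_gt0//; lra.
have ba : b / a = (n%:R - 1)^-1 by rewrite /b; field; rewrite !gt_eqF//; lra.
set r := expR (- (a * h)).
have rJ : r ^+ J = expR (- (a * (J%:R * h))) by rewrite decay_pow.
have nr : n%:R^-1 <= r ^+ J.
  rewrite rJ expRN lef_pV2 ?posrE ?expR_gt0//.
  by apply: ltW; apply: lt_le_trans (truncnS_gt _) _; rewrite ler_nat.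
have pu := refresh_prob_upper J a0 h0 b0; have pl := refresh_prob_lower J a0 h0 b0.
rewrite -/r ba in pu pl.
have pn : refresh_prob a b J h <= n%:R^-1.
  apply: le_trans pu _; rewrite ler_pdivrMl; last by lra.
  rewrite (_ : (n%:R - 1) * n%:R^-1 = 1 - n%:R^-1); last by field; rewrite gt_eqF.
  by rewrite lerD2l lerN2.
split; last split.
- apply: (@le_trans _ _ (n%:R * ((n%:R - 1)^-1 * (expR (- (b * (J.+1%:R * h))) * (r *
  (1 - r ^+ J)))))); last first.
    by rewrite ler_wpM2l// ltW.
  have r1 : 1 - delta / 4 <= r by rewrite /r ah expR_ge1Dx.
  have r2 : r ^+ J <= delta / 4.
    rewrite rJ expRN invf_ple ?posrE ?expR_gt0 ?divr_gt0//.
    apply: le_trans (expR_ge1Dx _).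
    rewrite (_ : a * (J%:R * h) = J%:R * (delta / 4)); last by rewrite -ah; ring.
    have : 16 / delta ^+ 2 * (delta / 4) <= J%:R * (delta / 4).
      by rewrite ler_wpM2r ?(ltW JB)// ltW// divr_gt0.
    rewrite (_ : 16 / delta ^+ 2 * (delta / 4) = (delta / 4)^-1); last by field; rewrite gt_eqF.
    lra.
  have r3 : 1 - delta / 4 <= expR (- (b * (J.+1%:R * h))).
    apply: le_trans (expR_ge1Dx _); rewrite lerD2l lerN2.
    rewrite (_ : b * (J.+1%:R * h) = J.+1%:R / (n%:R - 1) * (delta / 4)); last first.
      by rewrite -ah /b; field; rewrite gt_eqF//; lra.
    rewrite ler_piMl ?divr_ge0 ?(ltW d0)// ler_pdivrMr ?mul1r; last by lra.
    by rewrite lerBrDr natr1 ler_nat.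
  have : 1 <= n%:R * (n%:R - 1)^-1 :> R by rewrite ler_pdivlMr ?mul1r; lra.
  set y := n%:R * _ => y1; rewrite mulrA -/y.
  apply: (@le_trans _ _ ((1 - delta / 4) * ((1 - delta / 4) * (1 - delta / 4)))); first by nra.
  have d4 : 0 <= 1 - delta / 4 by lra.
  rewrite -[leLHS]mul1r; apply: ler_pM => //; first by rewrite !mulr_ge0.
  apply: ler_pM => //; first by rewrite mulr_ge0.
  by apply: ler_pM => //; lra.
- by rewrite -ler_pdivlMl// mulr1.
- by rewrite -rJ; exact: le_trans pn nr.
Qed.

Lemma pow4_le_expR (x : R) : 0 <= x -> x ^+ 4 <= 24 * expR x.
Proof.
move=> x0; have := expR_ge1Dxn 3 x0; rewrite (_ : 4`! = 24)%N//.
rewrite -(ler_pM2l (x := 24))//; lra.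
Qed.

End RefreshProbNear.

(** * The bound on the expected hitting time *)

(** Up to constants, the factors of [n] are one from the spacing [D], as
[theta] is at most [1 / (alpha * p)], and two from the bound on [q]. *)
Lemma expected_hitting_time_poly (R : realType) (alpha eps : R) :
  0 < alpha -> 0 < eps < 1 ->
  exists K : R, 0 <= K /\ exists N0 : nat, forall n : nat, (N0 <= n)%N -> (2 <= n)%N ->
    forall (d : measure_display) (T : measurableType d)
      (P : probability T R) (X : vertex_pair n * nat -> {RV P >-> R}),
    dynamic_ER_clocks alpha alpha (empty_graph n) X ->
    (\int[P]_w tau_hat (empty_graph n) X (eps * n%:R) w
       <= (K * (n%:R ^+ 3 * expR (24 * eps ^+ 3 * n%:R)))%:E)%E.
Proof.
move=> a0 e01; have /andP[e0 e1] := e01.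
have half0 : 0 < 1 / 2 :> R by lra.
pose delta := Num.min eps (1 / 2).
have d01 : 0 < delta <= 1 / 2 by rewrite lt_min e0 half0 ge_min lexx orbT.
have [J [h [h0 [N0 HN]]]] := refresh_prob_near a0 d01.
exists ((2 / alpha + J.+1%:R * h) * expR 5); split.
  by rewrite mulr_ge0 ?expR_ge0// addr_ge0 ?mulr_ge0 ?invr_ge0 ?ltW.
exists N0 => n nN n2 d T P X clk.
have [p1 [p2 pJ]] := HN n nN n2; set p := refresh_prob _ _ _ _ in p1 p2 pJ.
have n0 : 0 < n%:R :> R by rewrite ltr0n (leq_trans _ n2).
have n1 : 1 <= n%:R :> R by rewrite ler1n (leq_trans _ n2).
have d2 : 1 / 2 <= 1 - delta by have /andP[_ ?] := d01; lra.
have np : 1 / 2 <= n%:R * p by apply: le_trans p1.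
have pp : 0 < p by rewrite -(pmulr_rgt0 _ n0); lra.
have p01 : 0 <= p <= 1.
  rewrite ltW//=; apply: le_trans p2; rewrite ler_peMl// ltW//.
pose theta := - ln p / alpha.
have theta_prob : expR (- (alpha * theta)) = p.
  by rewrite /theta mulrCA divff ?gt_eqF// mulr1 opprK lnK.
have thJ : J%:R * h <= theta.
  by rewrite -(ler_pM2l a0) -lerN2 -ler_expR theta_prob.
have [k [kn qk]] := big_component_prob_bound n2 e01 p1 p2.
have q0 : 0 < big_component_prob n p k.
  have : 0 < n%:R ^+ 2 * big_component_prob n p k by apply: lt_le_trans qk; exact: expR_gt0.
  by rewrite pmulr_rgt0// exprn_gt0.
apply: le_trans (hitting_time_bound a0 n2 clk h0 thJ theta_prob p01 kn q0) _.
rewrite lee_fin ler_pdivrMr//.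
have thn : theta <= 2 / alpha * n%:R.
  rewrite /theta ler_pdivrMr// -lnV ?posrE// (_ : _ * alpha = 2 * n%:R); last by field;
    rewrite gt_eqF.
  have pV : 0 < p^-1 by rewrite invr_gt0.
  apply: le_trans (ltW (ln_sublinear pV)) _.
  by rewrite -[leLHS]div1r ler_pdivrMr//; lra.
have Jn : J.+1%:R * h <= J.+1%:R * h * n%:R by rewrite ler_peMr// mulr_ge0// ltW.
apply: (@le_trans _ _ ((2 / alpha + J.+1%:R * h) * n%:R)); first by rewrite mulrDl lerD.
have K0 : 0 <= 2 / alpha + J.+1%:R * h by rewrite addr_ge0 ?mulr_ge0 ?invr_ge0 ?ltW.
rewrite [leRHS](_ : _ = (2 / alpha + J.+1%:R * h) * n%:R *
  (expR (24 * eps ^+ 3 * n%:R + 5) * (n%:R ^+ 2 * big_component_prob n p k))); last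
    by rewrite [expR (_ + 5)]expRD; ring.
rewrite ler_peMr ?mulr_ge0 ?(ltW n0)//.
by rewrite -ler_pdivrMl ?expR_gt0// mulr1 -expRN.
Qed.

(** The power [n ^ 4] is absorbed by the exponential, and then
[1 / n <= n ^ (- 1 / 2)]. *)
Lemma poly_exp_absorption (R : realType) (eta : R) (n : nat) : 0 < eta -> (0 < n)%N ->
  n%:R ^+ 3 <= 24 / eta ^+ 4 * (n%:R `^ (- (1 / 2)) * expR (eta * n%:R)).
Proof.
move=> eta0 n0; have n0R : 0 < n%:R :> R by rewrite ltr0n.
have n1 : 1 <= n%:R :> R by rewrite ler1n.
have H1 : n%:R ^+ 4 <= 24 / eta ^+ 4 * expR (eta * n%:R).
  rewrite mulrAC ler_pdivlMr ?exprn_gt0// mulrC -exprMn.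
  by apply: pow4_le_expR; rewrite mulr_ge0// ltW.
have H2 : n%:R^-1 <= n%:R `^ (- (1 / 2)) :> R.
  by rewrite -powR_inv1 ?(ltW n0R)//; apply: ler_powR => //; lra.
rewrite (_ : n%:R ^+ 3 = n%:R ^+ 4 * n%:R^-1); last by field; rewrite gt_eqF.
rewrite [leRHS](_ : _ = 24 / eta ^+ 4 * expR (eta * n%:R) * n%:R `^ (- (1 / 2))); last by ring.
by apply: ler_pM.
Qed.

Theorem corollary2 (R : realType) (alpha : R) (halpha : 0 < alpha) :
  exists r : R -> R^o,
    r =O_ (0^'+) (fun x : R => x ^+ 3 : R^o) /\
    forall eps epsh : R, 0 < eps -> eps < epsh -> epsh < 1 ->
    exists M : R, \forall n \near \oo, (2 <= n)%N ->
      forall (d : measure_display) (T : measurableType d)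
        (P : probability T R) (X : vertex_pair n * nat -> {RV P >-> R}),
      dynamic_ER_clocks alpha alpha (empty_graph n) X ->
      (\int[P]_w tau_hat (empty_graph n) X (eps * n%:R) w
        <= (M * (n%:R `^ (- (1 / 2)) *
                 expR (n%:R * (epsh ^+ 2 / 16 + r epsh))))%:E)%E.
Proof.
exists (fun x => 24 * x ^+ 3); split.
  apply/eqOP; near=> k; near=> x; rewrite normrM ger0_norm//.
  by rewrite ler_wpM2r.
move=> eps epsh e0 ee e1.
have e01 : 0 < eps < 1 by rewrite e0 (lt_trans ee).
have [K [K0 [N0 HK]]] := expected_hitting_time_poly halpha e01.
(* the gain in the exponent when [eps] is replaced by [epsh] *)
pose eta := 24 * (epsh ^+ 3 - eps ^+ 3).
have eta0 : 0 < eta by rewrite mulr_gt0// subr_gt0 ltrXn2r// ?ltW// (lt_trans e0).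
exists (K * (24 / eta ^+ 4)); exists N0 => // n /= nN n2 d T P X clk.
apply: le_trans (HK n nN n2 d T P X clk) _; rewrite lee_fin -[leRHS]mulrA ler_wpM2l//.
have n0 : (0 < n)%N by exact: leq_trans n2.
apply: (le_trans (ler_wpM2r _ (poly_exp_absorption eta0 n0))); first exact: expR_ge0.
rewrite -[leLHS]mulrA; apply: ler_wpM2l; first by rewrite divr_ge0 ?exprn_ge0 ?(ltW eta0).
rewrite -[leLHS]mulrA; apply: ler_wpM2l; first exact: powR_ge0.
rewrite -expRD ler_expR -mulrDl mulrC ler_wpM2l//.
have : 0 <= epsh ^+ 2 / 16 by rewrite divr_ge0 ?exprn_ge0// ltW// (lt_trans e0).
by rewrite /eta; lra.
Unshelve. all: by end_near. Qed.
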